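(* Let $\alpha\in(0,1)$ and $\eta\in[0,1)$ with $\alpha-\eta>0$. For $K\in\mathcal{K}_\eta$ and $Q\in\mathcal{Q}_\alpha$ let $\mathcal{I}(K,Q):[0,T]^2\to\mathcal{L}(H)$ be the map $$\mathcal{I}(K,Q)(t,t'):=\int_0^t\int_0^{t'}K(t,r)\,d^2Q(r,r')\,K(t',r')^*.$$ Then for any $\zeta\in[0,\alpha-\eta)$ the integration map $\mathcal{I}$ is a continuous operator from $\mathcal{K}_\eta\times\mathcal{Q}_\alpha$ to $\mathcal{Q}_\zeta$. Moreover, there is a constant $C>0$ such that $$\|\mathcal{I}(K,Q)\|_{\mathcal{Q}_\zeta}\le C\,\|K\|_{\mathcal{K}_\eta}^2\,\|Q\|_{\mathcal{Q}_\alpha}.$$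
   Context: $T>0$, $H$ is a separable real Hilbert space, $\mathcal{L}(H)$ the bounded linear operators on $H$ with operator norm $\|\cdot\|_{op}$, $^*$ the adjoint, $\Delta_2^T=\{(t,s)\in[0,T]^2:t\ge s\}$. Rectangular increment: $\square_{(s,s'),(t,t')}f=f(t,t')-f(t,s')-f(s,t')+f(s,s')$. Kernels: for $\eta\in[0,1)$, $\mathcal{K}_\eta$ is the space of maps $K:\Delta_2^T\to\mathcal{L}(H)$ with $\|K\|_{\mathcal{K}_\eta}:=\sum_{i=1}^4\|K\|_{\eta,i}<\infty$, where $\|K\|_{\eta,1}=\sup_{t>s}\frac{\|K(t,s)\|_{op}}{|t-s|^{-\eta}}$, $\|K\|_{\eta,2}=\sup_{t>u>s,\ \theta\in[0,1]}\frac{\|K(t,s)-K(u,s)\|_{op}}{|t-u|^\theta|u-s|^{-\theta-\eta}}$, $\|K\|_{\eta,3}=\sup_{t>u>s,\ \theta\in[0,1]}\frac{\|K(t,u)-K(t,s)\|_{op}}{|u-s|^\theta|t-u|^{-\theta-\eta}}$, $\|K\|_{\eta,4}=\sup_{\tau'>\tau>s>r,\ \theta,\nu\in[0,1]}\frac{\|K(\tau',s)-K(\tau',r)-K(\tau,s)+K(\tau,r)\|_{op}}{|\tau-s|^{-\nu-\theta-\eta}|\tau'-\tau|^\nu|s-r|^\theta}$ (all times in $[0,T]$; values on the diagonal play no role). Regular covariance operators: for $\alpha\in[0,1)$, $\mathcal{Q}_\alpha$ is the class of $Q:[0,T]^2\to\mathcal{L}(H)$ with $\|Q\|_{\mathcal{Q}_\alpha}:=\|Q\|_{\alpha,(1,0)}+\|Q\|_{\alpha,(0,1)}+\|Q\|_{\alpha,(1,1)}<\infty$,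 where $\|Q\|_{\alpha,(1,0)}=\sup_{t>s,\,t'}\frac{\|Q(t,t')-Q(s,t')\|_{op}}{|t-s|^\alpha}$, $\|Q\|_{\alpha,(0,1)}=\sup_{t,\,t'>s'}\frac{\|Q(t,t')-Q(t,s')\|_{op}}{|t'-s'|^\alpha}$, $\|Q\|_{\alpha,(1,1)}=\sup_{t>s,\,t'>s'}\frac{\|\square_{(s,s'),(t,t')}Q\|_{op}}{(|t-s||t'-s'|)^\alpha}$. The double integral $\int_0^t\int_0^{t'}K(\tau,r)d^2Q(r,r')K(\tau',r')^*$ (for $t\le\tau$, $t'\le\tau'$) is the limit in operator norm, as the meshes of the partitions $\mathcal{P}$ of $[0,t]$ and $\mathcal{P}'$ of $[0,t']$ tend to $0$, of $\sum_{[u,v]\in\mathcal{P},[u',v']\in\mathcal{P}'}K(\tau,u)\,\square_{(u,u'),(v,v')}Q\,K(\tau',u')^*$; this limit exists under the stated hypotheses. Continuity is with respect to the (semi-)norms above. *)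

(* Defs.v *)
(* MathComp-Analysis *)
From HB Require Import structures.
From mathcomp Require Import all_boot all_order all_algebra.
From mathcomp Require Import all_classical all_reals all_analysis.
Import Order.TTheory GRing.Theory Num.Theory.
Import numFieldNormedType.Exports.

Set Implicit Arguments.
Unset Strict Implicit.
Unset Printing Implicit Defensive.

Local Open Scope classical_set_scope.
Local Open Scope ring_scope.

Definition bounded_linear (R : realType) (H : normedModType R) (f : H -> H) :=
  linear f /\ exists M : R, forall x, `|f x| <= M * `|x|.

Definition bounded_linear_pred (R : realType) (H : normedModType R) :
  {pred H -> H} := fun f => `[< bounded_linear f >].
Arguments bounded_linear_pred {R} H.

Record bop (R : realType) (H : normedModType R) := Bop {
  bop_fun :> H -> H;
  bopP : bop_fun \in bounded_linear_pred H }.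

Notation "''L' ( H )" := (bop H) (at level 8, format "''L' ( H )") : type_scope.

Section BoundedOperators.
Context {R : realType} {H : normedModType R}.
Local Notation L := 'L(H).

Lemma bounded_linear_submod : submod_closed (bounded_linear_pred H).
Proof.
split.
  apply/asboolP; split.
    move=> a x y; change (0 = a *: 0 + 0 :> H).
    by rewrite scaler0 addr0.
  by exists 0 => x; rewrite mul0r (_ : (0 : H -> H) x = 0)// normr0.
move=> a f g /asboolP[lf [M Mf]] /asboolP[lg [N Ng]]; apply/asboolP.
have E x : (a *: f + g) x = a *: f x + g x by [].
split.
  move=> b x y; rewrite !E lf lg !scalerDr !scalerA (mulrC b).
  by rewrite addrACA.
exists (`|a| * M + N) => x; rewrite E.
rewrite (le_trans (ler_normD _ _))// mulrDl lerD// normrZ -mulrA.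
exact: ler_wpM2l.
Qed.

HB.instance Definition _ := GRing.isSubmodClosed.Build R (H -> H)
  (bounded_linear_pred H) bounded_linear_submod.

HB.instance Definition _ := [isSub for @bop_fun R H].
HB.instance Definition _ := [Choice of L by <:].
HB.instance Definition _ := [SubChoice_isSubLmodule of L by <:].

Lemma bop_linear (A : L) : linear A.
Proof. by have /asboolP[] := bopP A. Qed.

Lemma bop_bounded (A : L) : exists2 M, 0 <= M & forall x, `|A x| <= M * `|x|.
Proof.
have /asboolP[_ [M Mf]] := bopP A; exists `|M| => // x.
by rewrite (le_trans (Mf x))// ler_wpM2r// ler_norm.
Qed.

HB.instance Definition _ (A : L) := GRing.isLinear.Build R H H _ A (bop_linear A).

Lemma bop_addE (A B : L) x : (A + B) x = A x + B x.
Proof. by []. Qed.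

Lemma bop_scaleE a (A : L) x : (a *: A) x = a *: A x.
Proof. by []. Qed.

Lemma bop_zeroE x : (0 : L) x = 0.
Proof. by []. Qed.

Lemma bop_ext (A B : L) : A =1 B -> A = B.
Proof. by move=> AB; apply/val_inj/funext. Qed.

Definition opnorm (A : L) : R := sup [set `|A x| | x in [set x | `|x| <= 1]].

Let opnorm_has_sup (A : L) : has_sup [set `|A x| | x in [set x | `|x| <= 1]].
Proof.
split; first by exists `|A 0|; exists 0 => //=; rewrite normr0.
have [M M0 AM] := bop_bounded A; exists M => _ [x /= x1 <-].
by rewrite (le_trans (AM x))// ler_piMr.
Qed.

Let opnorm_ub (A : L) x : `|x| <= 1 -> `|A x| <= opnorm A.
Proof.
by move=> x1; apply: (ub_le_sup (opnorm_has_sup A).2); exists x.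
Qed.

Lemma opnorm_ge0 (A : L) : 0 <= opnorm A.
Proof. by rewrite -(normr0 H) -(linear0 A) opnorm_ub// normr0. Qed.

Lemma opnorm_le (A : L) M : (forall x, `|x| <= 1 -> `|A x| <= M) ->
  opnorm A <= M.
Proof.
move=> AM; apply: ge_sup; first exact: (opnorm_has_sup A).1.
by move=> _ [x x1 <-]; exact: AM.
Qed.

Lemma le_opnorm (A : L) x : `|A x| <= opnorm A * `|x|.
Proof.
have [->|x0] := eqVneq x 0; first by rewrite linear0 !normr0 mulr0.
rewrite -ler_pdivrMr ?normr_gt0//.
have := @opnorm_ub A (`|x|^-1 *: x).
rewrite linearZ/= !normrZ normfV normr_id mulVf ?normr_eq0// mulrC.
exact.
Qed.

Let opnormD (A B : L) : opnorm (A + B) <= opnorm A + opnorm B.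
Proof.
apply: opnorm_le => x x1; rewrite bop_addE (le_trans (ler_normD _ _))//.
by rewrite lerD// opnorm_ub.
Qed.

Let opnormZ a (A : L) : opnorm (a *: A) = `|a| * opnorm A.
Proof.
have le b (B : L) : opnorm (b *: B) <= `|b| * opnorm B.
  apply: opnorm_le => x x1; rewrite bop_scaleE normrZ ler_wpM2l//.
  exact: opnorm_ub.
apply/eqP; rewrite eq_le le/=.
have [->|a0] := eqVneq a 0; first by rewrite normr0 mul0r opnorm_ge0.
by rewrite -ler_pdivlMl ?normr_gt0// -normfV -{1}(scale1r A) -(mulVf a0)
  -scalerA le.
Qed.

Let opnorm_eq0 (A : L) : opnorm A = 0 -> A = 0.
Proof.
move=> A0; apply: bop_ext => x; apply/eqP; rewrite -normr_le0.
by rewrite (le_trans (le_opnorm A x))// A0 mul0r.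
Qed.

HB.instance Definition _ :=
  Lmodule_isNormed.Build R L opnormD opnormZ opnorm_eq0.

Lemma bop_normE (A : L) : `|A| = opnorm A.
Proof. by []. Qed.

Lemma bcomp_subproof (A B : L) : A \o B \in bounded_linear_pred H.
Proof.
apply/asboolP; split; first by move=> a x y /=; rewrite !linearP.
have [M M0 AM] := bop_bounded A; have [N N0 BN] := bop_bounded B.
exists (M * N) => x /=; rewrite (le_trans (AM _))// -mulrA.
exact: ler_wpM2l.
Qed.

Definition bcomp (A B : L) : L := Bop (bcomp_subproof A B).

End BoundedOperators.

Definition separable (T : topologicalType) :=
  exists2 D : set T, countable D & dense D.

(* A real Hilbert space is a complete normed space whose norm is induced by an
   inner product; the library has no structure bundling the two. *)
Definition norm_from_dot (R : realType) (H : normedModType R)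
  (dot : {dot H for idfun}) := forall x : H, `|x| ^+ 2 = dot x x.

(* On a Hilbert space this set is a singleton, by the Riesz representation
   theorem. *)
Definition adjoint (R : realType) (H : normedModType R)
    (dot : {dot H for idfun}) (A : 'L(H)) : 'L(H) :=
  get [set B : 'L(H) | forall x y, dot (A x) y = dot x (B y)].

(* As in [itv_partition], the partition a = x_0 < ... < x_n = b is encoded by
   [:: x_1; ...; x_n], without its first point. *)
Definition partition_point (R : realType) (a : R) (P : seq R) (i : nat) : R :=
  nth 0 (a :: P) i.

Definition mesh (R : realType) (a : R) (P : seq R) : R :=
  \big[Num.max/0]_(i < size P)
    (partition_point a P i.+1 - partition_point a P i).

Definition partitions (R : realType) (a b : R) : set_system (seq R) :=
  filter_from [set e : R | 0 < e]
    (fun e => [set P | itv_partition a b P /\ mesh a P < e]).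

#[global] Instance partitions_filter (R : realType) (a b : R) :
  Filter (partitions a b).
Proof.
apply: filter_from_filter; first by exists 1 => /=.
move=> i j /= i0 j0; exists (Num.min i j); first by rewrite /= lt_min i0.
by move=> P [h]; rewrite lt_min => /andP[? ?]; split.
Qed.

Section VolterraIntegral.
Context {R : realType} {H : normedModType R}.
Implicit Types (T eta alpha t u s r : R).
Implicit Types K Q : R -> R -> 'L(H).

Definition rect_incr (p q : R * R) (f : R -> R -> 'L(H)) : 'L(H) :=
  f q.1 q.2 - f q.1 p.2 - f p.1 q.2 + f p.1 p.2.

(* Kernels and covariances are total functions on R x R. The seminorms below
   only read the values of K at 0 <= s < t <= T and those of Q on [0, T]^2. *)
Definition Knorm1 T eta K : \bar R := ereal_sup
  [set x | exists t s, [/\ 0 <= s, s < t, t <= T &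
    x = (`|K t s| / `|t - s| `^ (- eta))%:E]].

Definition Knorm2 T eta K : \bar R := ereal_sup
  [set x | exists t u s theta,
    [/\ 0 <= s, s < u, u < t, t <= T & 0 <= theta <= 1] /\
    x = (`|K t s - K u s| /
         (`|t - u| `^ theta * `|u - s| `^ (- theta - eta)))%:E].

Definition Knorm3 T eta K : \bar R := ereal_sup
  [set x | exists t u s theta,
    [/\ 0 <= s, s < u, u < t, t <= T & 0 <= theta <= 1] /\
    x = (`|K t u - K t s| /
         (`|u - s| `^ theta * `|t - u| `^ (- theta - eta)))%:E].

Definition Knorm4 T eta K : \bar R := ereal_sup
  [set x | exists tau' tau s r theta nu,
    [/\ 0 <= r, r < s, s < tau, tau < tau' & tau' <= T] /\
    [/\ 0 <= theta <= 1, 0 <= nu <= 1 &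
    x = (`|K tau' s - K tau' r - K tau s + K tau r| /
         (`|tau - s| `^ (- nu - theta - eta) *
          `|tau' - tau| `^ nu * `|s - r| `^ theta))%:E]].

Definition Knorm T eta K : \bar R :=
  (Knorm1 T eta K + Knorm2 T eta K + Knorm3 T eta K + Knorm4 T eta K)%E.

Definition Kspace T eta : set (R -> R -> 'L(H)) :=
  [set K | (Knorm T eta K < +oo)%E].

Definition Qnorm10 T alpha Q : \bar R := ereal_sup
  [set x | exists t s t', [/\ 0 <= s, s < t, t <= T & 0 <= t' <= T] /\
    x = (`|Q t t' - Q s t'| / `|t - s| `^ alpha)%:E].

Definition Qnorm01 T alpha Q : \bar R := ereal_sup
  [set x | exists t t' s', [/\ 0 <= t <= T, 0 <= s', s' < t' & t' <= T] /\
    x = (`|Q t t' - Q t s'| / `|t' - s'| `^ alpha)%:E].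

Definition Qnorm11 T alpha Q : \bar R := ereal_sup
  [set x | exists t s t' s',
    [/\ 0 <= s, s < t & t <= T] /\ [/\ 0 <= s', s' < t', t' <= T &
    x = (`|rect_incr (s, s') (t, t') Q| /
         (`|t - s| * `|t' - s'|) `^ alpha)%:E]].

Definition Qnorm T alpha Q : \bar R :=
  (Qnorm10 T alpha Q + Qnorm01 T alpha Q + Qnorm11 T alpha Q)%E.

Definition Qspace T alpha : set (R -> R -> 'L(H)) :=
  [set Q | (Qnorm T alpha Q < +oo)%E].

Variable dot : {dot H for idfun}.

Definition riemann_sum2 K Q (tau tau' : R) (PP : seq R * seq R) : 'L(H) :=
  let p := partition_point 0 PP.1 in
  let p' := partition_point 0 PP.2 in
  \sum_(i < size PP.1) \sum_(j < size PP.2)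
    bcomp (bcomp (K tau (p i))
                 (rect_incr (p i, p' j) (p i.+1, p' j.+1) Q))
          (adjoint dot (K tau' (p' j))).

Definition integral2_sums K Q tau tau' t t' : set_system 'L(H) :=
  riemann_sum2 K Q tau tau' @ filter_prod (partitions 0 t) (partitions 0 t').

Definition integral2 K Q tau tau' t t' : 'L(H) :=
  lim (integral2_sums K Q tau tau' t t').

Definition volterra_int K Q : R -> R -> 'L(H) :=
  fun t t' => integral2 K Q t t' t t'.

End VolterraIntegral.

(* Main.v *)
(* The double Riemann sum over P x P' is a one-dimensional Riemann sum, in r',
   of one-dimensional Riemann sums, in r, of Q(., r').  So everything follows
   from estimates on sums S_P(X) = sum f(u) (X(v) - X(u)), where X is
   alpha-Hoelder and f is a kernel singular at the right end t of the interval,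
   that are linear in the Hoelder seminorm of X.  Summing by parts pairs the
   increments of f with X(t) - X(u), whose decay at t compensates the
   singularity: with x = t - s and y = t - u for consecutive points s < u, each
   term is at most a constant times min(y^b, (x - y) y^(b-1)), b = alpha - eta,
   hence at most a constant times x^b - y^b, and the sum telescopes.  Summing by
   parts inside each cell of P compares S_P with its refinements and gives
   convergence with a rate.  For s < t the difference K(t, .) - K(s, .) is again
   such a kernel, singular at s with exponent eta + zeta and with an extra factor
   (t - s)^zeta: this is the zeta-Hoelder regularity of the integral.
   Continuity follows from the bound by trilinearity in (K, K, Q). *)
Require Import Defs.
From HB Require Import structures.
From mathcomp Require Import all_boot all_order all_algebra.
From mathcomp Require Import all_classical all_reals all_analysis.
From mathcomp Require Import ring lra.
Import Order.TTheory GRing.Theory Num.Theory.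
Import numFieldNormedType.Exports.

Set Implicit Arguments.
Unset Strict Implicit.
Unset Printing Implicit Defensive.

Local Open Scope classical_set_scope.
Local Open Scope ring_scope.

(** * Inequalities for real powers *)

Section PowerFunction.
Context {R : realType}.
Implicit Types a b x y : R.

(** From exp(u) >= 1 + u at u = b ln(1 + z), and ln(1 + z) = - ln(1/(1 + z)) >= z/(1 + z). *)
Lemma powR_bernoulli b z : 0 < b -> 0 <= z -> b * (z / (1 + z)) <= (1 + z) `^ b - 1.
Proof.
move=> b0 z0; have z1 : 0 < 1 + z by rewrite ltr_wpDr.
rewrite /powR gt_eqF// lerBrDl.
apply: le_trans (expR_ge1Dx _); rewrite lerD2l ler_pM2l//.
have -> : z / (1 + z) = - ((1 + z)^-1 - 1) by field; rewrite gt_eqF.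
rewrite lerNl -lnV ?posrE//.
have E : 1 + ((1 + z)^-1 - 1) = (1 + z)^-1 by rewrite addrCA subrr addr0.
have := @le_ln1Dx R ((1 + z)^-1 - 1); rewrite E; apply.
by rewrite ltrBrDl subrr invr_gt0.
Qed.

(** This is [powR_bernoulli] at z = x/y - 1, multiplied by y^b. *)
Lemma powR_increment b x y : 0 < b -> 0 < y -> y <= x ->
  b * (y `^ b * ((x - y) / x)) <= x `^ b - y `^ b.
Proof.
move=> b0 y0 yx; have x0 := lt_le_trans y0 yx.
have z0 : 0 <= x / y - 1 by rewrite subr_ge0 ler_pdivlMr// mul1r.
have := powR_bernoulli b0 z0; rewrite (addrC 1) subrK.
rewrite -(ler_pM2l (powR_gt0 b y0)) mulrBr mulr1 -powRM ?divr_ge0 ?(ltW x0) ?(ltW y0)//.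
rewrite (mulrC y) divfK ?gt_eqF//.
congr (_ <= _); field; apply/andP; split; rewrite gt_eqF//.
Qed.

(** One of the two bounds on m is always at most 2 y^b (x - y)/x: the first if y <= x - y, the
    second if x < 2y. Then [powR_increment] applies. *)
Lemma min_powR_telescope b x y m : 0 < b -> 0 < y -> y < x ->
  m <= y `^ b -> m <= (x - y) * y `^ (b - 1) ->
  m <= 2 / b * (x `^ b - y `^ b).
Proof.
move=> b0 y0 yx m1 m2; have x0 := lt_trans y0 yx.
have xy0 : 0 < x - y by rewrite subr_gt0.
have := powR_increment b0 y0 (ltW yx).
rewrite mulrC -ler_pdivlMr// => H.
have [xy|xy] := leP y (x - y).
  apply: (le_trans m1); rewrite mulrAC -mulrA.
  suff: y `^ b <= 2 * (y `^ b * ((x - y) / x)).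
    by move=> /le_trans; apply; rewrite ler_pM2l.
  rewrite mulrCA ler_peMr ?powR_ge0//.
  by rewrite mulrA ler_pdivlMr//; lra.
apply: (le_trans m2); rewrite mulrAC -mulrA.
suff: (x - y) * y `^ (b - 1) <= 2 * (y `^ b * ((x - y) / x)).
  by move=> /le_trans; apply; rewrite ler_pM2l.
have -> : y `^ (b - 1) = y `^ b / y.
  by rewrite powRB ?powRr1 ?(ltW y0)// (gt_eqF y0) implybT.
rewrite [leRHS](_ : _ = (x - y) * (y `^ b * (2 / x))); last by ring.
rewrite ler_pM2l// ler_pM2l ?powR_gt0// ler_pdivlMr// mulrC ler_pdivrMr//; lra.
Qed.

End PowerFunction.

(** * Partitions: mesh, fine partitions, common refinements, splitting *)

Section Partitions.
Context {R : realType}.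
Implicit Types (a b c t : R) (P W : seq R).

Lemma mesh_nil a : mesh a [::] = 0 :> R.
Proof. by rewrite /mesh big_ord0. Qed.

Lemma mesh_cons a b P : mesh a (b :: P) = Num.max (b - a) (mesh b P).
Proof. by rewrite /mesh /= big_ord_recl. Qed.

Lemma mesh_ge0 a P : 0 <= mesh a P.
Proof.
elim: P a => [|b P IH] a; first by rewrite mesh_nil.
by rewrite mesh_cons le_max IH orbT.
Qed.

Lemma mesh_cat a P W : mesh a (P ++ W) = Num.max (mesh a P) (mesh (last a P) W).
Proof.
elim: P a => [|b P IH] a /=; first by rewrite mesh_nil max_r ?mesh_ge0.
by rewrite !mesh_cons IH maxA.
Qed.

Lemma itv_partition_consP a b c P :
  itv_partition a b (c :: P) <-> a < c /\ itv_partition c b P.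
Proof.
rewrite /itv_partition/=; split=> [[/andP[ac cP] l]|[ac [cP l]]] //.
by rewrite ac cP.
Qed.

(** Steps of length e/2, by induction on a number of steps that covers [a, b]; the half makes the
    mesh strictly smaller than e. *)
Lemma itv_partition_fine a b e : a <= b -> 0 < e ->
  exists2 P, itv_partition a b P & mesh a P < e.
Proof.
move=> ab e0.
have [n /ltW] : exists n : nat, b - a < n%:R * (e / 2).
  exists (Num.bound ((b - a) / (e / 2))).
  have e20 : 0 < e / 2 by rewrite divr_gt0.
  by rewrite -ltr_pdivrMr// archi_boundP// divr_ge0 ?subr_ge0// ltW.
elim: n a ab => [|n IH] a ab.
  rewrite mul0r subr_le0 => ba; exists [::]; last by rewrite mesh_nil.
  by split=> //=; rewrite eq_le ab ba.
move: ab; rewrite le_eqVlt => /predU1P[<- _|ab].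
  by exists [::]; [split=> /=|rewrite mesh_nil].
have [bae _|eba H] := leP (b - a) (e / 2).
  exists [:: b]; first exact: itv_partition1.
  rewrite mesh_cons mesh_nil max_l ?subr_ge0 ?ltW//.
  by rewrite (le_lt_trans bae)// ltr_pdivrMr// ltr_pMr// ltr1n.
have [||P] := IH (a + e / 2).
- by rewrite -lerBrDl ltW.
- by move: H; rewrite -natr1 mulrDl mul1r; lra.
move=> Pab Pm; exists (a + e / 2 :: P).
  by apply/itv_partition_consP; rewrite ltrDl divr_gt0.
by rewrite mesh_cons gt_max Pm andbT; lra.
Qed.

Lemma partitions_proper a b : a <= b -> ProperFilter (partitions a b).
Proof.
move=> ab; apply: filter_from_proper => e /= e0.
by have [P] := itv_partition_fine ab e0; exists P.
Qed.

Lemma itv_partition_mem a b c P : itv_partition a b P -> c \in P -> a < c <= b.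
Proof.
elim: P a => // d P IH a /itv_partition_consP[ad dP].
rewrite inE => /predU1P[->|/(IH _ dP)/andP[dc ->]].
  by rewrite ad (itv_partition_le dP).
by rewrite (lt_trans ad dc).
Qed.

Lemma itv_partition_last_mem a b P : itv_partition a b P -> a < b -> b \in P.
Proof.
case: P => [/itv_partition_nil ->|c P [_ /= /eqP <-] _]; first by rewrite ltxx.
exact: mem_last.
Qed.

Lemma itv_partition_refine a b P W : itv_partition a b P -> itv_partition a b W ->
  exists V, [/\ itv_partition a b V, {subset P <= V} & {subset W <= V}].
Proof.
move=> aP aW; pose V := sort <=%R (undup (P ++ W)).
have memV c : (c \in V) = (c \in P) || (c \in W).
  by rewrite mem_sort mem_undup mem_cat.
have Vab c : c \in V -> a < c <= b.
  by rewrite memV => /orP[]; exact: itv_partition_mem.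
exists V; split; last 2 first.
- by move=> c cP; rewrite memV cP.
- by move=> c cW; rewrite memV cW orbT.
have paV : path <%R a V.
  rewrite lt_path_sortedE sort_lt_sorted undup_uniq andbT.
  by apply/allP => c /Vab/andP[].
(* It remains that V ends at b. No point exceeds b; conversely b is in V unless a = b, and the last
   point of an increasing list is its largest. *)
split=> //; rewrite eq_le; apply/andP; split.
  have := mem_last a V; rewrite inE => /predU1P[->|/Vab/andP[]//].
  exact: itv_partition_le aP.
have := itv_partition_le aP; rewrite le_eqVlt => /predU1P[<-|ab].
  exact: itv_partition_le (conj paV (eqxx _)).
have : b \in V by rewrite memV (itv_partition_last_mem aP).
move: paV => /[swap] /splitPr[V1 V2]; rewrite cat_path last_cat /= => /and3P[_ _ bV].
exact: itv_partition_le (conj bV (eqxx _)).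
Qed.

(** The last clause serves inductions along a coarser partition: its points beyond c are still found
    in [W2]. *)
Lemma itv_partition_split a b c W : itv_partition a b W -> c \in W ->
  exists W1 W2, [/\ W = W1 ++ W2, itv_partition a c W1, itv_partition c b W2 &
    forall d, d \in W -> c < d -> d \in W2].
Proof.
move=> + cW; case/splitPr: cW => W1 W2 [].
rewrite cat_path last_cat /= => /and3P[pW1 lc cW2] lb.
have aW1 : itv_partition a c (rcons W1 c).
  by split; [rewrite rcons_path pW1|rewrite last_rcons].
exists (rcons W1 c), W2; split=> // [|d]; first by rewrite cat_rcons.
rewrite -cat_rcons mem_cat => /orP[|//].
by move=> /(itv_partition_mem aW1)/andP[_]; rewrite leNgt => /negbTE->.
Qed.

End Partitions.

Lemma powRD_gt0 {R : realType} (y r s : R) : 0 < y ->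
  y `^ (r + s) = y `^ r * y `^ s.
Proof. by move=> y0; rewrite powRD// (gt_eqF y0) implybT. Qed.

Lemma ler_mul_powR {R : realType} (k q y r s m n : R) : 0 < y -> 0 <= m -> 0 <= n ->
  m <= k * y `^ r -> n <= q * y `^ s -> m * n <= k * q * y `^ (r + s).
Proof. by move=> y0 m0 n0 mk nq; rewrite powRD_gt0// mulrACA; exact: ler_pM. Qed.

(** * Riemann sums of a singular kernel against a Hoelder function *)

Section RiemannSums.
Context {R : realType} {V W : normedModType R}.
Implicit Types (act : W -> V -> V) (f : R -> W) (X : R -> V).
Implicit Types (k q a b c t eta alpha eps : R).

(** Covers both left composition with a kernel and right composition with its adjoint, so that one
    theory serves the two variables. *)
Definition contractive_bilinear act :=
  [/\ forall w v v', act w (v + v') = act w v + act w v',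
      forall w w' v, act (w + w') v = act w v + act w' v &
      forall w v, `|act w v| <= `|w| * `|v|].

Definition riemann_sum act f X a (P : seq R) : V :=
  \sum_(i < size P) act (f (partition_point a P i))
    (X (partition_point a P i.+1) - X (partition_point a P i)).

(* A kernel on [a, t) singular at t: the bounds of [K(t, .)] given by
   [Knorm1] and by [Knorm3] with exponents 0 and 1. *)
Definition singular_kernel f k eta a t :=
  (forall r, a <= r -> r < t -> `|f r| <= k * (t - r) `^ (- eta)) /\
  (forall s u, a <= s -> s < u -> u < t ->
     `|f u - f s| <= k * (t - u) `^ (- eta) /\
     `|f u - f s| <= k * ((u - s) * (t - u) `^ (- 1 - eta))).

Definition hoelder_on X q alpha a t :=
  forall s u, a <= s -> s < u -> u <= t -> `|X u - X s| <= q * (u - s) `^ alpha.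

Lemma singular_kernelW f k eta a a' t : a <= a' ->
  singular_kernel f k eta a t -> singular_kernel f k eta a' t.
Proof.
move=> aa' [f1 f2]; split=> [r ar rt|s u as_ su ut].
  by apply: f1 => //; exact: le_trans ar.
by apply: f2 => //; exact: le_trans as_.
Qed.

Lemma hoelder_onW X q alpha a a' t t' : a <= a' -> t' <= t ->
  hoelder_on X q alpha a t -> hoelder_on X q alpha a' t'.
Proof.
move=> aa' tt' hX s u as_ su ut; apply: hX => //; first exact: le_trans as_.
exact: le_trans tt'.
Qed.

Variable act : W -> V -> V.
Hypothesis act_bil : contractive_bilinear act.

Lemma actDr w v v' : act w (v + v') = act w v + act w v'.
Proof. by case: act_bil. Qed.

Lemma actDl w w' v : act (w + w') v = act w v + act w' v.
Proof. by case: act_bil. Qed.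

Lemma act_norm w v : `|act w v| <= `|w| * `|v|.
Proof. by case: act_bil. Qed.

Lemma act0r w : act w 0 = 0.
Proof. by apply: (@addIr _ (act w 0)); rewrite -actDr !add0r. Qed.

Lemma act0l v : act 0 v = 0.
Proof. by apply: (@addIr _ (act 0 v)); rewrite -actDl !add0r. Qed.

Lemma actNr w v : act w (- v) = - act w v.
Proof. by apply: (@addIr _ (act w v)); rewrite -actDr !addNr act0r. Qed.

Lemma actNl w v : act (- w) v = - act w v.
Proof. by apply: (@addIr _ (act w v)); rewrite -actDl !addNr act0l. Qed.

Lemma actBr w v v' : act w (v - v') = act w v - act w v'.
Proof. by rewrite actDr actNr. Qed.

Lemma actBl w w' v : act (w - w') v = act w v - act w' v.
Proof. by rewrite actDl actNl. Qed.

Lemma riemann_sum_nil f X a : riemann_sum act f X a [::] = 0.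
Proof. by rewrite /riemann_sum big_ord0. Qed.

Lemma riemann_sum_cons f X a b P : riemann_sum act f X a (b :: P) =
  act (f a) (X b - X a) + riemann_sum act f X b P.
Proof. by rewrite /riemann_sum /= big_ord_recl. Qed.

Lemma riemann_sum_cat f X a P P' : riemann_sum act f X a (P ++ P') =
  riemann_sum act f X a P + riemann_sum act f X (last a P) P'.
Proof.
elim: P a => [|b P IH] a /=; first by rewrite riemann_sum_nil add0r.
by rewrite !riemann_sum_cons IH addrA.
Qed.

Lemma riemann_sumBr f X Y a P : riemann_sum act f (X - Y) a P =
  riemann_sum act f X a P - riemann_sum act f Y a P.
Proof.
elim: P a => [|b P IH] a; first by rewrite !riemann_sum_nil subrr.
have E : (X - Y) b - (X - Y) a = (X b - X a) - (Y b - Y a).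
  by rewrite !fctE !opprD !opprK addrACA.
by rewrite !riemann_sum_cons IH E actBr opprD addrACA.
Qed.

Lemma riemann_sumBl f g X a P : riemann_sum act (f - g) X a P =
  riemann_sum act f X a P - riemann_sum act g X a P.
Proof.
elim: P a => [|b P IH] a; first by rewrite !riemann_sum_nil subrr.
by rewrite !riemann_sum_cons IH [in LHS]actBl opprD addrACA.
Qed.

(* Abel summation over the cell [a, b]: only the increments of f are paired
   with X b - X c, and the bounds telescope towards the singularity t. *)
Lemma riemann_sum_cell f X k q eta alpha a b t P :
  singular_kernel f k eta a t -> 0 <= k -> 0 <= q -> 0 < alpha - eta ->
  itv_partition a b P -> b <= t ->
  (forall c, a < c -> c < b -> `|X b - X c| <= q * (t - c) `^ alpha) ->
  `|act (f a) (X b - X a) - riemann_sum act f X a P| <=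
    2 / (alpha - eta) * (k * q) *
      ((t - a) `^ (alpha - eta) - (t - b) `^ (alpha - eta)).
Proof.
move=> + k0 q0 beta0 + bt; set beta := alpha - eta.
elim: P a => [|c P IH] a fk.
  move=> /itv_partition_nil -> _; rewrite riemann_sum_nil !subrr act0r subrr.
  by rewrite normr0 mulr0.
move=> /[dup] /itv_partition_le ab /itv_partition_consP[ac cP] hX.
have fkc : singular_kernel f k eta c t by exact: singular_kernelW (ltW ac) fk.
have hXc d : c < d -> d < b -> `|X b - X d| <= q * (t - d) `^ alpha.
  by move=> cd; apply: hX; exact: lt_trans cd.
have := itv_partition_le cP; rewrite le_eqVlt => /predU1P[cb|cb].
  move: cP; rewrite cb => /itv_partitionxx ->.
  rewrite riemann_sum_cons riemann_sum_nil addr0 subrr normr0.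
  rewrite !mulr_ge0 ?invr_ge0 ?(ltW beta0)// subr_ge0.
  have tb0 : 0 <= t - b by rewrite subr_ge0.
  by rewrite ge0_ler_powR ?(ltW beta0)// ?nnegrE ?subr_ge0 ?(le_trans ab)// lerD2l lerN2.
have ct := lt_le_trans cb bt.
(* Replacing f(a) by f(c) on [c, b] costs one product of increments; the rest is the same difference
   for the cell [c, b]. *)
have -> : act (f a) (X b - X a) - riemann_sum act f X a (c :: P) =
    act (f a - f c) (X b - X c) + (act (f c) (X b - X c) - riemann_sum act f X c P).
  have -> : X b - X a = (X b - X c) + (X c - X a) by rewrite addrA subrK.
  by rewrite riemann_sum_cons actDr actBl opprD !addrA addrK subrK.
apply: le_trans (ler_normD _ _) _.
have -> : (t - a) `^ beta - (t - b) `^ beta =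
  ((t - a) `^ beta - (t - c) `^ beta) + ((t - c) `^ beta - (t - b) `^ beta).
  by rewrite addrA subrK.
rewrite mulrDr; apply: lerD; last exact: IH.
have tc0 : 0 < t - c by rewrite subr_gt0.
apply: le_trans (act_norm _ _) _.
rewrite distrC; have [f1 f2] := fk.2 a c (lexx _) ac ct.
have hc := hX c ac cb.
(* The telescoping bound is applied after division by k q, so k q = 0 is treated apart. *)
have [kq0|kq0] := eqVneq (k * q) 0.
  rewrite kq0 mulr0 mul0r; apply: le_trans (ler_pM _ _ f1 hc) _ => //.
  by rewrite mulrACA kq0 mul0r.
have kq1 : 0 < k * q by rewrite lt_neqAle eq_sym kq0 mulr_ge0.
rewrite mulrAC -ler_pdivrMr//.
(* The two bounds on f(c) - f(a) in [singular_kernel] give the two bounds on m. *)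
apply: (@min_powR_telescope _ _ (t - a) (t - c)) => //.
- by rewrite ltrD2l ltrN2.
- rewrite ler_pdivrMr// [leRHS]mulrC /beta (addrC alpha).
  exact: ler_mul_powR.
- rewrite ler_pdivrMr//.
  have -> : t - a - (t - c) = c - a by ring.
  have -> : beta - 1 = - 1 - eta + alpha by rewrite /beta; ring.
  rewrite [leRHS](_ : _ = k * (c - a) * q * (t - c) `^ (- 1 - eta + alpha)).
    by apply: ler_mul_powR; rewrite // -mulrA.
  by ring.
Qed.

(** With [a, t] as a single cell, [riemann_sum_cell] compares the sum with the one term
    [act (f a) (X t - X a)]; that term accounts for the 1 in the constant. *)
Lemma riemann_sum_le f X k q eta alpha a t P :
  singular_kernel f k eta a t -> 0 <= k -> 0 <= q -> 0 < alpha - eta ->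
  itv_partition a t P -> hoelder_on X q alpha a t ->
  `|riemann_sum act f X a P| <=
    (1 + 2 / (alpha - eta)) * (k * q) * (t - a) `^ (alpha - eta).
Proof.
move=> fk k0 q0 beta0 aP hX.
have := itv_partition_le aP; rewrite le_eqVlt => /predU1P[at_|at_].
  move: aP; rewrite at_ => /itv_partitionxx ->.
  rewrite riemann_sum_nil normr0 !mulr_ge0// ?powR_ge0// addr_ge0//.
  by rewrite divr_ge0// ltW.
have ta0 : 0 < t - a by rewrite subr_gt0.
have H : `|act (f a) (X t - X a) - riemann_sum act f X a P| <=
    2 / (alpha - eta) * (k * q) * (t - a) `^ (alpha - eta).
  have := @riemann_sum_cell f X k q eta alpha a t t P fk k0 q0 beta0 aP (lexx _).
  rewrite subrr powR0 ?gt_eqF// subr0; apply=> c ac ct.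
  by apply: hX => //; exact: ltW.
have -> : riemann_sum act f X a P = act (f a) (X t - X a) -
   (act (f a) (X t - X a) - riemann_sum act f X a P) by rewrite subKr.
apply: le_trans (ler_normB _ _) _.
rewrite mulrDl mulrDl; apply: lerD => //.
apply: le_trans (act_norm _ _) _; rewrite mul1r.
rewrite (addrC alpha); apply: ler_mul_powR => //; first exact: fk.1.
exact: hX.
Qed.

(** The Hoelder exponent is split: eps pays for the factor d^eps, and alpha - eps still compensates
    the singularity. Each cell of P is compared with its refinement, and the bounds telescope. *)
Lemma riemann_sum_refine f X k q eta alpha eps d a t P P' :
  singular_kernel f k eta a t -> 0 <= eta -> 0 <= k -> 0 <= q ->
  0 <= eps -> 0 < alpha - eps - eta ->
  itv_partition a t P -> itv_partition a t P' -> {subset P <= P'} ->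
  mesh a P <= d -> hoelder_on X q alpha a t ->
  `|riemann_sum act f X a P - riemann_sum act f X a P'| <=
    2 / (alpha - eps - eta) * (k * (q * d `^ eps)) * (t - a) `^ (alpha - eps - eta).
Proof.
move=> + eta0 k0 q0 eps0 beta0; set beta := alpha - eps - eta.
have qd0 : 0 <= q * d `^ eps by rewrite mulr_ge0 ?powR_ge0.
elim: P a P' => [|b P IH] a P' fk.
  move=> /itv_partition_nil -> /itv_partitionxx -> _ _ _.
  by rewrite subrr normr0 !mulr_ge0 ?powR_ge0 ?invr_ge0 ?(ltW beta0).
move=> /itv_partition_consP[ab bP] aP' PP'; rewrite mesh_cons ge_max.
move=> /andP[bad bPd] hX.
have bP' : b \in P' by apply: PP'; rewrite inE eqxx.
have [W1 [W2 [E aW1 bW2 W2P]]] := itv_partition_split aP' bP'.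
have bt := itv_partition_le bP.
have fkb : singular_kernel f k eta b t by exact: singular_kernelW (ltW ab) fk.
have hXb : hoelder_on X q alpha b t by exact: hoelder_onW (ltW ab) (lexx _) hX.
rewrite E riemann_sum_cat riemann_sum_cons.
have -> : last a W1 = b by case: aW1 => _ /eqP.
rewrite opprD addrACA; apply: le_trans (ler_normD _ _) _.
rewrite -[(t - a) `^ beta](subrK ((t - b) `^ beta)) mulrDr; apply: lerD; last first.
  apply: IH => // c cP; apply: W2P; first by apply: PP'; rewrite inE cP orbT.
  by have /andP[] := itv_partition_mem bP cP.
apply: (riemann_sum_cell fk) => // c ac cb.
have bc0 : 0 < b - c by rewrite subr_gt0.
(* Of the factors (b - c)^eps and (b - c)^(alpha - eps), the first is bounded by d^eps and the
   second by the power of t - c that [riemann_sum_cell] asks for. *)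
apply: le_trans (hX c b (ltW ac) cb bt) _.
have -> : (b - c) `^ alpha = (b - c) `^ eps * (b - c) `^ (alpha - eps).
  by rewrite -powRD_gt0// (addrC eps) subrK.
rewrite -mulrA ler_wpM2l//.
apply: ler_pM; rewrite ?powR_ge0//; apply: ge0_ler_powR; rewrite ?nnegrE//.
- exact: ltW.
- by rewrite (le_trans _ bad)// subr_ge0 ltW.
- by rewrite (le_trans _ bad)// lerD2l lerN2 ltW.
- by rewrite ltW// (le_lt_trans eta0)// -subr_gt0.
- exact: ltW.
- by rewrite subr_ge0 (le_trans (ltW cb)).
- by rewrite lerD2r.
Qed.

End RiemannSums.

(** * Limits along partitions, and Young integrals of singular kernels *)

Lemma norm_cvg_le {R : realType} {V : normedModType R} {T : Type}
    {F : set_system T} {FF : ProperFilter F} (g : T -> V) (l : V) (M : R) :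
  g @ F --> l -> (\forall x \near F, `|g x| <= M) -> `|l| <= M.
Proof. by move=> /cvg_norm gl; exact: cvgr_to_le gl. Qed.

Lemma powR_small {R : realType} (e r M : R) : 0 < e -> 0 < r -> 0 <= M ->
  exists2 d : R, 0 < d & M * d `^ r < e.
Proof.
move=> e0 r0 M0; have M1 : 0 < M + 1 by rewrite ltr_wpDl.
have eM : 0 < e / (M + 1) by rewrite divr_gt0.
exists ((e / (M + 1)) `^ r^-1); first exact: powR_gt0.
rewrite -powRrM mulVf ?gt_eqF// powRr1 ?(ltW eM)//.
by rewrite mulrCA gtr_pMr// ltr_pdivrMr// mul1r ltrDl.
Qed.

Lemma partitions_mesh {R : realType} (a b d : R) : 0 < d ->
  \forall P \near partitions a b, itv_partition a b P /\ mesh a P < d.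
Proof. by exists d. Qed.

(** An integral over [a, c] can be computed along partitions through b, hence cut at b. *)
Lemma partitions_cat {R : realType} (a b c : R) : a <= b -> b <= c ->
  (PP.1 ++ PP.2) @[PP --> filter_prod (partitions a b) (partitions b c)] -->
  partitions a c.
Proof.
move=> ab bc A [d /= d0 dA].
exists ([set P | itv_partition a b P /\ mesh a P < d],
        [set P | itv_partition b c P /\ mesh b P < d]) => /=.
  by split; exact: partitions_mesh.
move=> [P P'] /= [[aP Pd] [bP' P'd]]; apply: dA; split.
  exact: itv_partition_cat aP bP'.
by rewrite mesh_cat (eqP aP.2) gt_max Pd.
Qed.

Section YoungIntegral.
Context {R : realType} {V : completeNormedModType R} {W : normedModType R}.
Implicit Types (f g : R -> W) (X Y : R -> V).
Implicit Types (k q a b c t s eta alpha d : R).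
Variable act : W -> V -> V.
Hypothesis act_bil : contractive_bilinear act.

Definition young_integral f X a t : V :=
  lim (riemann_sum act f X a @ partitions a t).

(** Half of the margin beta is spent on the mesh, half on the singularity; the leading 2 counts two
    comparisons with a common refinement. *)
Definition young_modulus (beta a t d : R) : R :=
  2 * (2 / (beta / 2) * (t - a) `^ (beta / 2)) * d `^ (beta / 2).

Lemma riemann_sum_modulus f X k q eta alpha d a t P P' :
  singular_kernel f k eta a t -> 0 <= eta -> 0 <= k -> 0 <= q ->
  0 < alpha - eta -> hoelder_on X q alpha a t ->
  itv_partition a t P -> itv_partition a t P' -> mesh a P <= d -> mesh a P' <= d ->
  `|riemann_sum act f X a P - riemann_sum act f X a P'| <=
    k * q * young_modulus (alpha - eta) a t d.
Proof.
move=> fk eta0 k0 q0 beta0 hX aP aP' Pd P'd.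
set beta := alpha - eta in beta0 *.
have [U [aU PU P'U]] := itv_partition_refine aP aP'.
have E : alpha - beta / 2 - eta = beta / 2 by rewrite /beta; lra.
have b20 : 0 < beta / 2 by rewrite divr_gt0.
have H S : itv_partition a t S -> {subset S <= U} -> mesh a S <= d ->
    `|riemann_sum act f X a S - riemann_sum act f X a U| <=
    k * q * young_modulus beta a t d / 2.
  move=> aS SU Sd.
  have := @riemann_sum_refine R V W act act_bil f X k q eta alpha (beta / 2) d a t S U
    fk eta0 k0 q0 (ltW b20).
  rewrite E => /(_ b20 aS aU SU Sd hX) /le_trans; apply.
  by rewrite le_eqVlt; apply/orP; left; apply/eqP; rewrite /young_modulus; field; rewrite gt_eqF.
apply: le_trans (ler_distD (riemann_sum act f X a U) _ _) _.
rewrite [leRHS]splitr; apply: lerD; first exact: H.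
by rewrite distrC; exact: H.
Qed.

Lemma young_integral_cvg f X k q eta alpha a t :
  singular_kernel f k eta a t -> 0 <= eta -> 0 <= k -> 0 <= q ->
  0 < alpha - eta -> hoelder_on X q alpha a t -> a <= t ->
  riemann_sum act f X a P @[P --> partitions a t] --> young_integral f X a t.
Proof.
move=> fk eta0 k0 q0 beta0 hX at_.
have PF := partitions_proper at_.
apply: cauchy_cvg; apply: cauchy_exP => e e0.
have b20 : 0 < (alpha - eta) / 2 by rewrite divr_gt0.
have [|d d0 dM] := @powR_small R e ((alpha - eta) / 2)
  (k * q * (2 * (2 / ((alpha - eta) / 2) * (t - a) `^ ((alpha - eta) / 2)))) e0 b20.
  by rewrite !mulr_ge0 ?powR_ge0 ?invr_ge0 ?(ltW b20).
have [P0 aP0 P0d] := itv_partition_fine at_ d0.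
exists (riemann_sum act f X a P0), d => //= P [aP Pd].
rewrite /= -ball_normE /=; apply: le_lt_trans dM.
rewrite -mulrA.
by apply: (riemann_sum_modulus fk) => //; exact: ltW.
Qed.

(** The estimate of [riemann_sum_modulus], in the limit in P' with P fixed. *)
Lemma young_integral_modulus f X k q eta alpha d a t P :
  singular_kernel f k eta a t -> 0 <= eta -> 0 <= k -> 0 <= q ->
  0 < alpha - eta -> hoelder_on X q alpha a t ->
  itv_partition a t P -> mesh a P <= d -> 0 < d ->
  `|riemann_sum act f X a P - young_integral f X a t| <=
    k * q * young_modulus (alpha - eta) a t d.
Proof.
move=> fk eta0 k0 q0 beta0 hX aP Pd d0.
have at_ := itv_partition_le aP; have PF := partitions_proper at_.
have H := young_integral_cvg fk eta0 k0 q0 beta0 hX at_.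
have {}H : riemann_sum act f X a P - riemann_sum act f X a P' @[P' --> partitions a t]
    --> riemann_sum act f X a P - young_integral f X a t.
  by apply: cvgB H; exact: cvg_cst.
apply: norm_cvg_le H _.
near=> P'.
have [aP' P'd] : itv_partition a t P' /\ mesh a P' < d.
  by near: P'; exact: partitions_mesh.
by apply: (riemann_sum_modulus fk) => //; exact: ltW.
Unshelve. all: by end_near. Qed.

Lemma young_integral_le f X k q eta alpha a t :
  singular_kernel f k eta a t -> 0 <= eta -> 0 <= k -> 0 <= q ->
  0 < alpha - eta -> hoelder_on X q alpha a t -> a <= t ->
  `|young_integral f X a t| <=
    (1 + 2 / (alpha - eta)) * (k * q) * (t - a) `^ (alpha - eta).
Proof.
move=> fk eta0 k0 q0 beta0 hX at_; have PF := partitions_proper at_.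
apply: norm_cvg_le (young_integral_cvg fk eta0 k0 q0 beta0 hX at_) _.
near=> P; apply: riemann_sum_le => //.
have [] // : itv_partition a t P /\ mesh a P < 1.
by near: P; exact: partitions_mesh.
Unshelve. all: by end_near. Qed.

Lemma young_integralBr f X Y k q q' eta alpha a t :
  singular_kernel f k eta a t -> 0 <= eta -> 0 <= k -> 0 <= q -> 0 <= q' ->
  0 < alpha - eta -> hoelder_on X q alpha a t -> hoelder_on Y q' alpha a t -> a <= t ->
  young_integral f (X - Y) a t = young_integral f X a t - young_integral f Y a t.
Proof.
move=> fk eta0 k0 q0 q'0 beta0 hX hY at_; have PF := partitions_proper at_.
apply: cvg_lim => //.
rewrite (_ : riemann_sum act f (X - Y) a = riemann_sum act f X a - riemann_sum act f Y a).
  apply: cvgB; first exact: (young_integral_cvg fk eta0 k0 q0 beta0 hX at_).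
  exact: (young_integral_cvg fk eta0 k0 q'0 beta0 hY at_).
by apply/funext => P; exact: riemann_sumBr.
Qed.

(* The part of the integral over [s, t] is short; on [a, s] only the difference
   of the kernels is integrated. *)
Lemma young_integral_increment f g X k k' l q eta eta' alpha a s t :
  singular_kernel f k eta a t -> singular_kernel g k' eta a s ->
  singular_kernel (f - g) l eta' a s -> 0 <= eta -> 0 <= eta' ->
  0 <= k -> 0 <= k' -> 0 <= l -> 0 <= q ->
  0 < alpha - eta -> 0 < alpha - eta' -> hoelder_on X q alpha a t ->
  a <= s -> s <= t ->
  `|young_integral f X a t - young_integral g X a s| <=
    (1 + 2 / (alpha - eta')) * (l * q) * (s - a) `^ (alpha - eta') +
    (1 + 2 / (alpha - eta)) * (k * q) * (t - s) `^ (alpha - eta).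
Proof.
move=> fk gk fgl eta0 eta'0 k0 k'0 l0 q0 b0 b'0 hX as_ st.
have at_ := le_trans as_ st.
have PFs := partitions_proper as_; have PFt := partitions_proper st.
have hXs : hoelder_on X q alpha a s by exact: hoelder_onW hX.
have hXt : hoelder_on X q alpha s t by exact: hoelder_onW hX.
have Hf := young_integral_cvg fk eta0 k0 q0 b0 hX at_.
have Hg := young_integral_cvg gk eta0 k'0 q0 b0 hXs as_.
(* Both limits are taken along pairs (P, P'), so that the sums of f and g share the partition P of
   [a, s]. *)
have Hf2 := cvg_comp _ _ (partitions_cat as_ st) Hf.
have fst_cvg : PP.1 @[PP --> filter_prod (partitions a s) (partitions s t)] -->
    partitions a s by exact: cvg_fst.
have Hg2 := cvg_comp _ _ fst_cvg Hg.
have H : riemann_sum act f X a (PP.1 ++ PP.2) - riemann_sum act g X a PP.1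
    @[PP --> filter_prod (partitions a s) (partitions s t)] -->
    young_integral f X a t - young_integral g X a s by exact: cvgB Hf2 Hg2.
apply: norm_cvg_le H _.
exists ([set P | itv_partition a s P /\ mesh a P < 1],
        [set P | itv_partition s t P /\ mesh s P < 1]) => /=.
  by split; exact: partitions_mesh.
move=> [P P'] /= [[aP _] [sP' _]].
rewrite riemann_sum_cat (eqP aP.2) addrAC -riemann_sumBl//.
apply: le_trans (ler_normD _ _) _; apply: lerD; first exact: riemann_sum_le.
by apply: riemann_sum_le => //; exact: singular_kernelW fk.
Qed.

(** What is used of a bound k on [Knorm]: the first clause comes from [Knorm1] and [Knorm3], the
    second from [Knorm2] and [Knorm4]. *)
Definition volterra_kernel (K : R -> R -> W) k eta zeta T :=
  (forall t, 0 <= t -> t <= T -> singular_kernel (K t) k eta 0 t) /\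
  (forall s t, 0 <= s -> s < t -> t <= T ->
     singular_kernel (K t - K s) (k * (t - s) `^ zeta) (eta + zeta) 0 s).

(** Adds the constants of the value and increment estimates, with leftover powers of lengths bounded
    by powers of T, so that one constant serves both. *)
Definition volterra_const (eta alpha zeta T : R) : R :=
  (1 + 2 / (alpha - eta)) * (T `^ (alpha - eta) + T `^ (alpha - eta - zeta)) +
  (1 + 2 / (alpha - (eta + zeta))) * T `^ (alpha - (eta + zeta)).

Lemma singular_kernelD f g k k' eta a t : singular_kernel f k eta a t ->
  singular_kernel g k' eta a t -> singular_kernel (f + g) (k + k') eta a t.
Proof.
move=> [f1 f2] [g1 g2]; split=> [r ar rt|s u as_ su ut].
  by rewrite mulrDl; apply: le_trans (ler_normD _ _) _; rewrite lerD ?f1 ?g1.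
have [f3 f4] := f2 s u as_ su ut; have [g3 g4] := g2 s u as_ su ut.
rewrite !(mulrDl k) !fctE opprD addrACA.
by split; apply: le_trans (ler_normD _ _) _; apply: lerD.
Qed.

Lemma volterra_kernelD (K K' : R -> R -> W) k k' eta zeta T :
  volterra_kernel K k eta zeta T -> volterra_kernel K' k' eta zeta T ->
  volterra_kernel (K + K') (k + k') eta zeta T.
Proof.
move=> [K1 K2] [K'1 K'2]; split=> [t t0 tT|s t s0 st tT].
  by apply: singular_kernelD; [exact: K1|exact: K'1].
have -> : (K + K') t - (K + K') s = (K t - K s) + (K' t - K' s).
  by apply/funext => r; rewrite !fctE opprD addrACA.
by rewrite mulrDl; apply: singular_kernelD; [exact: K2|exact: K'2].
Qed.

Lemma volterra_const_gt0 eta alpha zeta T :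
  0 <= zeta -> 0 < alpha - (eta + zeta) -> 0 < T -> 0 < volterra_const eta alpha zeta T.
Proof.
move=> z0 b0 T0; have b1 : 0 < alpha - eta by lra.
by rewrite addr_gt0// mulr_gt0// ?addr_gt0// ?divr_gt0// powR_gt0.
Qed.

Variables (K : R -> R -> W) (k eta alpha zeta T : R).
Hypothesis Kk : volterra_kernel K k eta zeta T.
Hypotheses (k_ge0 : 0 <= k) (eta_ge0 : 0 <= eta) (zeta_ge0 : 0 <= zeta).
Hypotheses (zeta_lt : 0 < alpha - (eta + zeta)).

Let beta_gt0 : 0 < alpha - eta. Proof. by move: zeta_ge0 zeta_lt; lra. Qed.

Lemma volterra_integral_le X q t : 0 <= q -> hoelder_on X q alpha 0 t ->
  0 <= t -> t <= T ->
  `|young_integral (K t) X 0 t| <= volterra_const eta alpha zeta T * (k * q).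
Proof.
move=> q0 hX t0 tT.
apply: le_trans (young_integral_le (Kk.1 t t0 tT) eta_ge0 k_ge0 q0 beta_gt0 hX t0) _.
rewrite mulrAC subr0 ler_wpM2r ?mulr_ge0// /volterra_const mulrDr -addrA.
apply: le_trans (_ : _ <= (1 + 2 / (alpha - eta)) * T `^ (alpha - eta)) _.
  rewrite ler_wpM2l ?addr_ge0 ?divr_ge0 ?(ltW beta_gt0)//.
  by rewrite ge0_ler_powR ?nnegrE ?(ltW beta_gt0)// (le_trans t0).
by rewrite lerDl addr_ge0// mulr_ge0 ?powR_ge0 ?addr_ge0 ?divr_ge0 ?ltW.
Qed.

Lemma volterra_integral_increment X q s t : 0 <= q -> hoelder_on X q alpha 0 t ->
  0 <= s -> s < t -> t <= T ->
  `|young_integral (K t) X 0 t - young_integral (K s) X 0 s| <=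
    volterra_const eta alpha zeta T * (k * q * (t - s) `^ zeta).
Proof.
move=> q0 hX s0 st tT; have t0 := le_trans s0 (ltW st).
have sT := le_trans (ltW st) tT; have T0 := le_trans t0 tT.
have ts0 : 0 < t - s by rewrite subr_gt0.
have l0 : 0 <= k * (t - s) `^ zeta by rewrite mulr_ge0 ?powR_ge0.
have ez0 : 0 <= eta + zeta by rewrite addr_ge0.
apply: le_trans (young_integral_increment (Kk.1 t t0 tT) (Kk.1 s s0 sT)
  (Kk.2 s t s0 st tT) eta_ge0 ez0 k_ge0 k_ge0 l0 q0 beta_gt0 zeta_lt hX s0 (ltW st)) _.
rewrite subr0 /volterra_const [leRHS]mulrDl [leRHS]addrC.
have kqz0 : 0 <= k * q * (t - s) `^ zeta by rewrite !mulr_ge0 ?powR_ge0.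
apply: lerD.
  have -> : k * (t - s) `^ zeta * q = k * q * (t - s) `^ zeta by rewrite mulrAC.
  rewrite mulrAC ler_wpM2r// ler_wpM2l ?addr_ge0 ?divr_ge0 ?(ltW zeta_lt)//.
  by rewrite ge0_ler_powR ?nnegrE ?(ltW zeta_lt)//.
(* On the short piece [s, t] only (t - s)^zeta has to be kept; the remaining power is bounded by one
   of T. *)
have -> : (t - s) `^ (alpha - eta) = (t - s) `^ (alpha - eta - zeta) * (t - s) `^ zeta.
  by rewrite -powRD_gt0// subrK.
rewrite [leLHS](_ : _ = (1 + 2 / (alpha - eta)) * (t - s) `^ (alpha - eta - zeta) *
  (k * q * (t - s) `^ zeta)); last by ring.
rewrite ler_wpM2r// ler_wpM2l ?addr_ge0 ?divr_ge0 ?(ltW beta_gt0)//.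
apply: le_trans (_ : _ <= T `^ (alpha - eta - zeta)) _.
  rewrite ge0_ler_powR ?nnegrE ?(ltW ts0)//.
    by rewrite -addrA -opprD ltW.
  by rewrite lerBlDr (le_trans tT)// lerDl.
by rewrite lerDr powR_ge0.
Qed.

End YoungIntegral.

(** * Double sums and double integrals as iterated ones *)

Section DoubleIntegral.
Context {R : realType} {V : completeNormedModType R} {W : normedModType R}.
Implicit Types (f g : R -> W) (X Y : R -> V) (K : R -> R -> W) (Q : R -> R -> V).
Implicit Types (k q a b c t s eta alpha zeta d T : R).
Variables act1 act2 : W -> V -> V.
Hypothesis act1_bil : contractive_bilinear act1.
Hypothesis act2_bil : contractive_bilinear act2.

Definition double_sum f g Q (PP : seq R * seq R) : V :=
  riemann_sum act2 g (fun r' => riemann_sum act1 f (Q ^~ r') 0 PP.1) 0 PP.2.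

Definition double_integral f g Q t t' : V :=
  young_integral act2 g (fun r' => young_integral act1 f (Q ^~ r') 0 t) 0 t'.

(** The first clause comes from [Qnorm10], the second from [Qnorm11]: it is the Hoelder regularity
    of r' -> Q(., r') for the Hoelder seminorm, which the inner integral turns into that of its
    values. *)
Definition regular_covariance Q q alpha T :=
  (forall r', 0 <= r' -> r' <= T -> hoelder_on (Q ^~ r') q alpha 0 T) /\
  (forall s' u', 0 <= s' -> s' < u' -> u' <= T ->
     hoelder_on (Q ^~ u' - Q ^~ s') (q * (u' - s') `^ alpha) alpha 0 T).

Lemma hoelder_onD X Y q q' alpha a t : hoelder_on X q alpha a t ->
  hoelder_on Y q' alpha a t -> hoelder_on (X + Y) (q + q') alpha a t.
Proof.
move=> hX hY s u as_ su ut; rewrite mulrDl !fctE opprD addrACA.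
by apply: le_trans (ler_normD _ _) _; apply: lerD; [exact: hX|exact: hY].
Qed.

Lemma regular_covarianceD Q Q' q q' alpha T :
  regular_covariance Q q alpha T -> regular_covariance Q' q' alpha T ->
  regular_covariance (Q + Q') (q + q') alpha T.
Proof.
move=> [Q1 Q2] [Q'1 Q'2]; split=> [r r0 rT|s u s0 su uT].
  by apply: hoelder_onD; [exact: Q1|exact: Q'1].
have -> : (Q + Q')^~ u - (Q + Q')^~ s = (Q^~ u - Q^~ s) + (Q'^~ u - Q'^~ s).
  by apply/funext => r; rewrite !fctE opprD addrACA.
by rewrite mulrDl; apply: hoelder_onD; [exact: Q2|exact: Q'2].
Qed.

Lemma double_sumBk f f' g Q PP : double_sum (f - f') g Q PP =
  double_sum f g Q PP - double_sum f' g Q PP.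
Proof.
rewrite /double_sum -(riemann_sumBr act2_bil); congr riemann_sum.
by apply/funext => r'; rewrite !fctE (riemann_sumBl act1_bil).
Qed.

Lemma double_sumkB f g g' Q PP : double_sum f (g - g') Q PP =
  double_sum f g Q PP - double_sum f g' Q PP.
Proof. exact: riemann_sumBl. Qed.

Lemma double_sumB f g Q Q' PP : double_sum f g (Q - Q') PP =
  double_sum f g Q PP - double_sum f g Q' PP.
Proof.
rewrite /double_sum -(riemann_sumBr act2_bil); congr riemann_sum.
by apply/funext => r'; rewrite !fctE -(riemann_sumBr act1_bil).
Qed.

(** By linearity, the increment in r' is the integral against Q(., u) - Q(., s), whose Hoelder
    constant is q (u - s)^alpha. *)
Lemma young_integral_hoelder f Q k q eta alpha t T :
  singular_kernel f k eta 0 t -> 0 <= eta -> 0 <= k -> 0 <= q ->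
  0 < alpha - eta -> regular_covariance Q q alpha T -> 0 <= t -> t <= T ->
  hoelder_on (fun r' => young_integral act1 f (Q ^~ r') 0 t)
    ((1 + 2 / (alpha - eta)) * (k * q) * t `^ (alpha - eta)) alpha 0 T.
Proof.
move=> fk eta0 k0 q0 b0 [Q1 Q2] t0 tT s u s0 su uT.
have qu0 : 0 <= q * (u - s) `^ alpha by rewrite mulr_ge0 ?powR_ge0.
have u0 := le_trans s0 (ltW su); have sT := le_trans (ltW su) uT.
have hu : hoelder_on (Q ^~ u) q alpha 0 t by exact: hoelder_onW (Q1 u u0 uT).
have hs : hoelder_on (Q ^~ s) q alpha 0 t by exact: hoelder_onW (Q1 s s0 sT).
rewrite -(young_integralBr act1_bil fk eta0 k0 q0 q0 b0 hu hs t0).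
have h : hoelder_on (Q ^~ u - Q ^~ s) (q * (u - s) `^ alpha) alpha 0 t.
  exact: hoelder_onW (Q2 s u s0 su uT).
apply: le_trans (young_integral_le act1_bil fk eta0 k0 qu0 b0 h t0) _.
by rewrite subr0 le_eqVlt; apply/orP; left; apply/eqP; ring.
Qed.

(** The error is the outer sum of the inner error Z plus the outer error for the inner integral Y.
    Since Z is Hoelder in r' with a constant of order d^(beta/2), its outer sum is small uniformly
    in P'. *)
Lemma double_sum_cvg f g Q k l q eta alpha t t' T :
  singular_kernel f k eta 0 t -> singular_kernel g l eta 0 t' ->
  0 <= eta -> 0 <= k -> 0 <= l -> 0 <= q ->
  0 < alpha - eta -> regular_covariance Q q alpha T ->
  0 <= t -> t <= T -> 0 <= t' -> t' <= T ->
  double_sum f g Q @ filter_prod (partitions 0 t) (partitions 0 t') -->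
  double_integral f g Q t t'.
Proof.
move=> fk gl eta0 k0 l0 q0 b0 Qr t0 tT t'0 t'T.
have [Q1 Q2] := Qr.
set beta := alpha - eta in b0 *; have b20 : 0 < beta / 2 by rewrite divr_gt0.
(* [A] is the factor of d^(beta/2) in [young_modulus], [D] the one of k q in [riemann_sum_le].
   Below, [D t' * A t] stems from the inner error and [D t * A t'] from the outer one. *)
pose A r := 2 * (2 / (beta / 2) * (r - 0) `^ (beta / 2)) : R.
have A0 r : 0 <= A r by rewrite !mulr_ge0 ?powR_ge0 ?invr_ge0 ?(ltW b20).
pose D r := (1 + 2 / beta) * r `^ beta : R.
have D0 r : 0 <= D r by rewrite mulr_ge0 ?powR_ge0 ?addr_ge0 ?divr_ge0 ?(ltW b0).
apply/cvgrPdist_le => e e0.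
have [|d d0 dM] := @powR_small R e (beta / 2)
    (k * l * q * (D t' * A t + D t * A t')) e0 b20.
  apply: mulr_ge0; first by rewrite !mulr_ge0.
  by apply: addr_ge0; apply: mulr_ge0; rewrite ?A0 ?D0.
exists ([set P | itv_partition 0 t P /\ mesh 0 P < d],
        [set P | itv_partition 0 t' P /\ mesh 0 P < d]) => /=.
  by split; exact: partitions_mesh.
move=> [P P'] /= [[tP Pd] [tP' P'd]]; rewrite distrC.
pose Y r' := young_integral act1 f (Q ^~ r') 0 t.
pose Z r' := riemann_sum act1 f (Q ^~ r') 0 P - Y r'.
have -> : double_sum f g Q (P, P') - double_integral f g Q t t' =
    riemann_sum act2 g Z 0 P' +
    (riemann_sum act2 g Y 0 P' - young_integral act2 g Y 0 t').
  by rewrite (riemann_sumBr act2_bil) addrA subrK.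
have hY : hoelder_on Y ((1 + 2 / beta) * (k * q) * t `^ beta) alpha 0 t'.
  exact: hoelder_onW (young_integral_hoelder fk eta0 k0 q0 b0 Qr t0 tT).
have hZ : hoelder_on Z (k * q * (A t * d `^ (beta / 2))) alpha 0 t'.
  move=> s u s0 su ut'; have uT := le_trans ut' t'T.
  have qu0 : 0 <= q * (u - s) `^ alpha by rewrite mulr_ge0 ?powR_ge0.
  have u0 := le_trans s0 (ltW su); have sT := le_trans (ltW su) uT.
  have hu : hoelder_on (Q ^~ u) q alpha 0 t by exact: hoelder_onW (Q1 u u0 uT).
  have hs : hoelder_on (Q ^~ s) q alpha 0 t by exact: hoelder_onW (Q1 s s0 sT).
  have -> : Z u - Z s = riemann_sum act1 f (Q ^~ u - Q ^~ s) 0 P -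
      young_integral act1 f (Q ^~ u - Q ^~ s) 0 t.
    rewrite (young_integralBr act1_bil fk eta0 k0 q0 q0 b0 hu hs t0).
    by rewrite (riemann_sumBr act1_bil) /Z !opprD !opprK addrACA.
  have h : hoelder_on (Q ^~ u - Q ^~ s) (q * (u - s) `^ alpha) alpha 0 t.
    exact: hoelder_onW (Q2 s u s0 su uT).
  have := young_integral_modulus act1_bil fk eta0 k0 qu0 b0 h tP (ltW Pd) d0.
  move=> /le_trans; apply.
  by rewrite /young_modulus -/beta le_eqVlt; apply/orP; left; apply/eqP; rewrite /A; ring.
have qY0 : 0 <= (1 + 2 / beta) * (k * q) * t `^ beta.
  by rewrite mulrAC; apply: mulr_ge0; [exact: D0|exact: mulr_ge0].
have qZ0 : 0 <= k * q * (A t * d `^ (beta / 2)).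
  by apply: mulr_ge0; [exact: mulr_ge0|rewrite mulr_ge0 ?A0 ?powR_ge0].
apply: le_trans (ler_normD _ _) _; apply: le_trans (ltW dM).
apply: (@le_trans _ _ (l * (k * q * (A t * d `^ (beta / 2))) * D t' +
   l * (D t * (k * q)) * (A t' * d `^ (beta / 2)))); last first.
  by rewrite le_eqVlt; apply/orP; left; apply/eqP; ring.
apply: lerD.
  apply: le_trans (riemann_sum_le act2_bil gl l0 qZ0 b0 tP' hZ) _.
  by rewrite subr0 -/beta le_eqVlt; apply/orP; left; apply/eqP; rewrite /D; ring.
apply: le_trans (young_integral_modulus act2_bil gl eta0 l0 qY0 b0 hY tP' (ltW P'd) d0) _.
by rewrite le_eqVlt; apply/orP; left; apply/eqP; rewrite /D /A /young_modulus -/beta; ring.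
Qed.

(** The identity f'g'Q' - fgQ = (f' - f)g'Q' + f(g' - g)Q' + fg(Q' - Q) is algebraic for the sums
    and passes to the limit. *)
Lemma double_sum_telescope {F : set_system (seq R * seq R)} {FF : ProperFilter F}
    f g Q f' g' Q' (a a' b1 b2 b3 : V) :
  double_sum f g Q @ F --> a -> double_sum f' g' Q' @ F --> a' ->
  double_sum (f' - f) g' Q' @ F --> b1 -> double_sum f (g' - g) Q' @ F --> b2 ->
  double_sum f g (Q' - Q) @ F --> b3 -> a' - a = b1 + b2 + b3.
Proof.
move=> Fa Fa' F1 F2 F3.
have H : (fun PP => double_sum f' g' Q' PP - double_sum f g Q PP) @ F --> b1 + b2 + b3.
  have -> : (fun PP => double_sum f' g' Q' PP - double_sum f g Q PP) =
      double_sum (f' - f) g' Q' + double_sum f (g' - g) Q' + double_sum f g (Q' - Q).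
    apply/funext => PP; rewrite !fctE double_sumBk double_sumkB double_sumB.
    by rewrite !addrA !subrK.
  by apply: cvgD F3; exact: cvgD.
have H' : (fun PP => double_sum f' g' Q' PP - double_sum f g Q PP) @ F --> a' - a.
  exact: cvgB.
exact: cvg_unique H' H.
Qed.

Variables (K L : R -> R -> W) (Q : R -> R -> V) (k l q eta alpha zeta T : R).
Hypothesis Kk : volterra_kernel K k eta zeta T.
Hypothesis Ll : volterra_kernel L l eta zeta T.
Hypothesis Qq : regular_covariance Q q alpha T.
Hypotheses (k_ge0 : 0 <= k) (l_ge0 : 0 <= l) (q_ge0 : 0 <= q).
Hypotheses (eta_ge0 : 0 <= eta) (zeta_ge0 : 0 <= zeta).
Hypotheses (zeta_lt : 0 < alpha - (eta + zeta)) (T_gt0 : 0 < T).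

Let I t t' := double_integral (K t) (L t') Q t t'.
Let Y t r' := young_integral act1 (K t) (Q ^~ r') 0 t.
Let D := volterra_const eta alpha zeta T.
Let D_ge0 : 0 <= D. Proof. by rewrite ltW// volterra_const_gt0. Qed.
Let beta_gt0 : 0 < alpha - eta. Proof. by move: zeta_ge0 zeta_lt; lra. Qed.

Let YB t s' u' : 0 <= t -> t <= T -> 0 <= s' -> s' < u' -> u' <= T ->
  Y t u' - Y t s' = young_integral act1 (K t) (Q ^~ u' - Q ^~ s') 0 t.
Proof.
move=> t0 tT s0 su uT; have [Q1 Q2] := Qq.
have u0 := le_trans s0 (ltW su); have sT := le_trans (ltW su) uT.
have hu : hoelder_on (Q ^~ u') q alpha 0 t by exact: hoelder_onW (Q1 u' u0 uT).
have hs : hoelder_on (Q ^~ s') q alpha 0 t by exact: hoelder_onW (Q1 s' s0 sT).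
by rewrite (young_integralBr act1_bil (Kk.1 t t0 tT) eta_ge0 k_ge0 q_ge0 q_ge0
  beta_gt0 hu hs t0).
Qed.

Let Y_hoelder t : 0 <= t -> t <= T -> hoelder_on (Y t) (D * (k * q)) alpha 0 T.
Proof.
move=> t0 tT s u s0 su uT; rewrite YB//.
have h : hoelder_on (Q ^~ u - Q ^~ s) (q * (u - s) `^ alpha) alpha 0 t.
  exact: hoelder_onW (Qq.2 s u s0 su uT).
have qu0 : 0 <= q * (u - s) `^ alpha by rewrite mulr_ge0 ?powR_ge0.
apply: le_trans (volterra_integral_le act1_bil Kk k_ge0 eta_ge0 zeta_ge0 zeta_lt
  qu0 h t0 tT) _.
by rewrite !mulrA.
Qed.

(** The mixed increment of Y is the increment in time of an integral against Q(., u) - Q(., r), so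
    the one-variable estimate applies. *)
Let YB_hoelder s t : 0 <= s -> s < t -> t <= T ->
  hoelder_on (Y t - Y s) (D * (k * q * (t - s) `^ zeta)) alpha 0 T.
Proof.
move=> s0 st tT r u r0 ru uT; have t0 := le_trans s0 (ltW st).
have sT := le_trans (ltW st) tT.
have h : hoelder_on (Q ^~ u - Q ^~ r) (q * (u - r) `^ alpha) alpha 0 t.
  exact: hoelder_onW (Qq.2 r u r0 ru uT).
have qu0 : 0 <= q * (u - r) `^ alpha by rewrite mulr_ge0 ?powR_ge0.
have -> : (Y t - Y s) u - (Y t - Y s) r = (Y t u - Y t r) - (Y s u - Y s r).
  by rewrite !fctE !opprD !opprK addrACA.
rewrite !YB//.
apply: le_trans (volterra_integral_increment act1_bil Kk k_ge0 eta_ge0 zeta_ge0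
  zeta_lt qu0 h s0 st tT) _.
by rewrite -/D le_eqVlt; apply/orP; left; apply/eqP; ring.
Qed.

Let YBE s t t' : 0 <= s -> s < t -> t <= T -> 0 <= t' -> t' <= T ->
  I t t' - I s t' = young_integral act2 (L t') (Y t - Y s) 0 t'.
Proof.
move=> s0 st tT t'0 t'T; have t0 := le_trans s0 (ltW st).
have sT := le_trans (ltW st) tT.
have Dkq : 0 <= D * (k * q) by rewrite !mulr_ge0.
have ht : hoelder_on (Y t) (D * (k * q)) alpha 0 t'.
  exact: hoelder_onW (Y_hoelder t0 tT).
have hs : hoelder_on (Y s) (D * (k * q)) alpha 0 t'.
  exact: hoelder_onW (Y_hoelder s0 sT).
by rewrite (young_integralBr act2_bil (Ll.1 t' t'0 t'T) eta_ge0 l_ge0 Dkq Dkq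
  beta_gt0 ht hs t'0).
Qed.

(** The increment in t is the outer integral against Y t - Y s, whose Hoelder constant carries (t -
    s)^zeta. Each variable contributes one factor D. *)
Lemma double_integral_incr10 s t t' : 0 <= s -> s < t -> t <= T ->
  0 <= t' -> t' <= T ->
  `|I t t' - I s t'| <= D ^+ 2 * (k * l * q) * (t - s) `^ zeta.
Proof.
move=> s0 st tT t'0 t'T; rewrite YBE//.
have h : hoelder_on (Y t - Y s) (D * (k * q * (t - s) `^ zeta)) alpha 0 t'.
  exact: hoelder_onW (YB_hoelder s0 st tT).
have q0 : 0 <= D * (k * q * (t - s) `^ zeta) by rewrite !mulr_ge0 ?powR_ge0.
apply: le_trans (volterra_integral_le act2_bil Ll l_ge0 eta_ge0 zeta_ge0 zeta_lt
  q0 h t'0 t'T) _.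
by rewrite -/D le_eqVlt; apply/orP; left; apply/eqP; ring.
Qed.

Lemma double_integral_incr01 t s' t' : 0 <= t -> t <= T ->
  0 <= s' -> s' < t' -> t' <= T ->
  `|I t t' - I t s'| <= D ^+ 2 * (k * l * q) * (t' - s') `^ zeta.
Proof.
move=> t0 tT s0 st t'T.
have h : hoelder_on (Y t) (D * (k * q)) alpha 0 t'.
  exact: hoelder_onW (Y_hoelder t0 tT).
have q0 : 0 <= D * (k * q) by rewrite !mulr_ge0.
apply: le_trans (volterra_integral_increment act2_bil Ll l_ge0 eta_ge0 zeta_ge0
  zeta_lt q0 h s0 st t'T) _.
by rewrite -/D le_eqVlt; apply/orP; left; apply/eqP; ring.
Qed.

(** Taking the increment in t' of the outer integral against Y t - Y s adds the factor (t' -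
    s')^zeta. *)
Lemma double_integral_incr11 s t s' t' : 0 <= s -> s < t -> t <= T ->
  0 <= s' -> s' < t' -> t' <= T ->
  `|I t t' - I t s' - I s t' + I s s'| <=
    D ^+ 2 * (k * l * q) * ((t - s) * (t' - s')) `^ zeta.
Proof.
move=> s0 st tT s'0 st' t'T.
have t'0 := le_trans s'0 (ltW st'); have s'T := le_trans (ltW st') t'T.
have -> : I t t' - I t s' - I s t' + I s s' = (I t t' - I s t') - (I t s' - I s s').
  by rewrite opprB addrA (addrAC (I t t')) [in RHS]addrAC.
rewrite !YBE//.
have h : hoelder_on (Y t - Y s) (D * (k * q * (t - s) `^ zeta)) alpha 0 t'.
  exact: hoelder_onW (YB_hoelder s0 st tT).
have q0 : 0 <= D * (k * q * (t - s) `^ zeta) by rewrite !mulr_ge0 ?powR_ge0.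
apply: le_trans (volterra_integral_increment act2_bil Ll l_ge0 eta_ge0 zeta_ge0
  zeta_lt q0 h s'0 st' t'T) _.
rewrite powRM ?subr_ge0 ?(ltW st) ?(ltW st')//.
by rewrite -/D le_eqVlt; apply/orP; left; apply/eqP; ring.
Qed.

End DoubleIntegral.

(** * Completeness of L(H), and composition of operators *)

Section BopComplete.
Context {R : realType} {H : completeNormedModType R}.
Local Notation L := 'L(H).

(** The limit is taken pointwise; the Cauchy property makes the convergence uniform relative to the
    norm of x ([near_l]), whence the boundedness of the limit and convergence in operator norm. *)
Lemma bop_complete (F : set_system L) : ProperFilter F -> cauchy F -> cvg F.
Proof.
move=> FF /cauchyP Fc.
have Fxc x : cvg ((fun A : L => A x) @ F).
  apply: cauchy_cvg; apply: cauchy_exP => e e0.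
  have x1 : 0 < `|x| + 1 by rewrite ltr_wpDl.
  have [A FA] := Fc (e / (`|x| + 1)) (divr_gt0 e0 x1).
  exists (A x); rewrite nbhs_simpl /=; apply: filterS FA => B.
  rewrite -!ball_normE /= => AB.
  have -> : A x - B x = (A - B) x by [].
  apply: le_lt_trans (le_opnorm _ _) _.
  rewrite -bop_normE; apply: le_lt_trans (_ : _ <= `|A - B| * (`|x| + 1)) _.
    by rewrite ler_wpM2l// lerDl.
  by rewrite -ltr_pdivlMr.
pose l x := lim ((fun A : L => A x) @ F).
have near_l e : 0 < e -> \forall A \near F, forall x, `|(A : L) x - l x| <= e * `|x|.
  move=> e0; have [|A0 FA0] := Fc (e / 2); first by rewrite divr_gt0.
  apply: filterS (FA0) => A AA0 x.
  have H1 : A x - (B : L) x @[B --> F] --> A x - l x.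
    by apply: cvgB (Fxc x); exact: cvg_cst.
  apply: norm_cvg_le H1 _; apply: filterS FA0 => B A0B.
  have /ltW AB : `|A - B| < e.
    by have := ball_splitr AA0 A0B; rewrite -ball_normE.
  have -> : A x - B x = (A - B) x by [].
  by apply: le_trans (le_opnorm _ _) _; rewrite ler_wpM2r.
have ll : bounded_linear l.
  split.
    move=> a x y; apply: cvg_lim => //.
    rewrite (_ : (fun A : L => A (a *: x + y)) = (fun A : L => a *: A x + A y)).
      by apply: cvgD; [apply: cvgZr; exact: Fxc|exact: Fxc].
    by apply/funext => A; rewrite linearP.
  have [A Al] := filter_ex (near_l 1 ltr01).
  exists (opnorm A + 1) => x; rewrite -(subKr (A x) (l x)).
  apply: le_trans (ler_normB _ _) _; rewrite mulrDl lerD ?le_opnorm//.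
pose l' : L := Bop (asboolT ll).
suff : F --> l' by move=> Fl; apply/cvg_ex; exists l'.
apply/cvgrPdist_le => e e0; apply: filterS (near_l e e0) => A Al.
rewrite bop_normE; apply: opnorm_le => x x1.
have -> : (l' - A) x = l x - A x by [].
by rewrite distrC (le_trans (Al x))// ler_piMr// ltW.
Qed.

HB.instance Definition _ := Uniform_isComplete.Build L bop_complete.

Lemma bcompDl (A B C : L) : bcomp (A + B) C = bcomp A C + bcomp B C.
Proof. exact: bop_ext. Qed.

Lemma bcompDr (A B C : L) : bcomp C (A + B) = bcomp C A + bcomp C B.
Proof. by apply: bop_ext => x; rewrite bop_addE /= -linearD. Qed.

Lemma bcomp_norm (A B : L) : `|bcomp A B| <= `|A| * `|B|.
Proof.
rewrite !bop_normE; apply: opnorm_le => x x1 /=.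
apply: le_trans (le_opnorm _ _) _; rewrite ler_wpM2l ?opnorm_ge0//.
by apply: le_trans (le_opnorm _ _) _; rewrite ler_piMr ?opnorm_ge0.
Qed.

Lemma bcomp_contractive : contractive_bilinear (@bcomp R H).
Proof.
split=> [w v v'|w w' v|w v]; [exact: bcompDr|exact: bcompDl|exact: bcomp_norm].
Qed.

End BopComplete.

(** * Inner products, the Riesz representation and adjoints *)

Section Riesz.
Context {R : realType} {H : completeNormedModType R} (dot : {dot H for idfun}).
Hypothesis Hdot : norm_from_dot dot.
Implicit Types (x y z : H).

Lemma dotC x y : dot x y = dot y x.
Proof. by rewrite hermC expr0 mul1r. Qed.

Lemma dotZl a x y : dot (a *: x) y = a * dot x y.
Proof. by rewrite dotC linearZr_LR /= dotC. Qed.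

Lemma sqr_normD x y : `|x + y| ^+ 2 = `|x| ^+ 2 + 2 * dot x y + `|y| ^+ 2.
Proof. by rewrite !Hdot linearDl !linearDr /= (dotC y x); ring. Qed.

Lemma parallelogram x y :
  `|x + y| ^+ 2 + `|x - y| ^+ 2 = 2 * (`|x| ^+ 2 + `|y| ^+ 2).
Proof. by rewrite !sqr_normD normrN linearNr; ring. Qed.

Lemma dot_inj x y : (forall z, dot z x = dot z y) -> x = y.
Proof.
move=> xy; apply/eqP; rewrite -subr_eq0 -normr_eq0 -sqrf_eq0 Hdot.
by rewrite linearBr /= xy subrr.
Qed.

(** The squared norm of |y|^2 x - <x, y> y equals |y|^2 (|x|^2 |y|^2 - <x, y>^2). *)
Lemma cauchy_schwarz x y : `|dot x y| <= `|x| * `|y|.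
Proof.
have [->|y0] := eqVneq y 0; first by rewrite linear0r !normr0 mulr0.
have y2 : 0 < `|y| ^+ 2 by rewrite exprn_gt0// normr_gt0.
rewrite -(@ler_pXn2r _ 2)// ?nnegrE ?mulr_ge0// exprMn real_normK ?num_real//.
have : 0 <= `|(`|y| ^+ 2) *: x - dot x y *: y| ^+ 2 by rewrite exprn_ge0.
rewrite sqr_normD normrN !normrZ linearNr linearZr_LR /= dotZl.
rewrite !exprMn !real_normK ?num_real// => H0.
rewrite -subr_ge0 -(pmulr_rge0 _ y2); apply: le_trans H0 _.
by rewrite le_eqVlt; apply/orP; left; apply/eqP; ring.
Qed.

(* Riesz representation: by the parallelogram law, the sublevel sets of
   |x|^2 - 2 phi x near its infimum form a Cauchy filter, and its limit is a
   minimizer, at which the first variation vanishes. *)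
Lemma riesz (phi : H -> R) (M : R) :
  (forall a x y, phi (a *: x + y) = a * phi x + phi y) ->
  (forall x, `|phi x| <= M * `|x|) -> exists y, forall x, phi x = dot x y.
Proof.
move=> phiL phiM.
have phiD x y : phi (x + y) = phi x + phi y by rewrite -{1}(scale1r x) phiL mul1r.
have phi0 : phi 0 = 0 by apply: (@addIr _ (phi 0)); rewrite -phiD !add0r.
have phiZ a x : phi (a *: x) = a * phi x by rewrite -(addr0 (a *: x)) phiL phi0 addr0.
have phiB x y : phi (x - y) = phi x - phi y by rewrite -scaleN1r phiD phiZ mulN1r.
pose J x := `|x| ^+ 2 - 2 * phi x.
have J_ge x : - M ^+ 2 <= J x.
  have h1 : phi x <= M * `|x| by apply: le_trans (phiM x); exact: ler_norm.
  have h2 : 0 <= (`|x| - M) ^+ 2 by exact: sqr_ge0.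
  by rewrite /J; nra.
have J_inf : has_inf (range J).
  by split; [exists (J 0), 0|exists (- M ^+ 2) => _ [x _ <-]].
pose m := inf (range J).
have mJ x : m <= J x by apply: ge_inf; [case: J_inf|exists x].
pose F : set_system H := filter_from [set e : R | 0 < e] (fun e => [set x | J x < m + e]).
have FF : ProperFilter F.
  apply: filter_from_proper; last first.
    by move=> e /= e0; have [_ [x _ <-] xe] := inf_adherent e0 J_inf; exists x.
  apply: filter_from_filter; first by exists 1 => /=.
  move=> i j /= i0 j0; exists (Num.min i j); first by rewrite /= lt_min i0.
  by move=> x /=; rewrite -!ltrBlDl lt_min => /andP.
(* The terms in phi cancel in the parallelogram law; as J >= m at the midpoint, two near-minimizers
   are close to each other. *)
have JD x y : `|x - y| ^+ 2 = 2 * J x + 2 * J y - 4 * J (2^-1 *: (x + y)).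
  have := parallelogram x y; rewrite /J normrZ exprMn phiZ phiD.
  rewrite ger0_norm ?invr_ge0//; set a := `|x - y|; set b := `|x + y|.
  by lra.
have Fcvg : cvg F.
  apply: cauchy_cvg; apply: cauchy_exP => e e0.
  (* If J x and J z are below m + e^2/4, then [JD] gives |x - z|^2 < 4 (m + e^2/4) - 4m = e^2. *)
  have e20 : 0 < e ^+ 2 / 4 by rewrite divr_gt0 ?exprn_gt0.
  have [_ [x _ <-] xe] := inf_adherent e20 J_inf; exists x.
  exists (e ^+ 2 / 4) => // z /= ze; rewrite -ball_normE /=.
  rewrite -(@ltr_pXn2r _ 2)// ?nnegrE ?(ltW e0)// JD.
  by have := mJ (2^-1 *: (x + z)); rewrite -/m in xe; lra.
have [y Fy] : exists y, (fun x : H => x) @ F --> y by exact/cvg_ex.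
have Jy : J y <= m.
  apply/ler_addgt0Pr => e e0.
  have Jcvg : J x @[x --> F] --> J y.
    apply: cvgB; first by rewrite !expr2; apply: cvgM; exact: cvg_norm.
    apply: cvgZr; apply/cvgrPdist_le => d d0.
    have M1 : 0 < `|M| + 1 by rewrite ltr_wpDl.
    have /cvgrPdist_le/(_ (d / (`|M| + 1)) (divr_gt0 d0 M1)) := Fy.
    apply: filterS => x; rewrite ler_pdivlMr// => yx.
    rewrite -phiB; apply: le_trans (phiM _) (le_trans _ yx).
    rewrite mulrC ler_wpM2l//.
    by apply: le_trans (ler_norm _) _; rewrite lerDl.
  apply: (cvgr_to_le Jcvg).
  by exists e => //= x /ltW.
exists y => x; rewrite dotC.
have var t : 0 <= t ^+ 2 * `|x| ^+ 2 + 2 * t * (dot y x - phi x).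
  have := le_trans Jy (mJ (y + t *: x)).
  rewrite /J sqr_normD phiD phiZ linearZr_LR /= normrZ exprMn real_normK ?num_real//.
  by lra.
set c := dot y x - phi x in var.
apply/eqP; rewrite eq_sym -subr_eq0 -/c; apply/eqP.
(* If x = 0, the variation is linear in t, and t = - c forces c = 0; otherwise t = - c/|x|^2
   minimizes the quadratic, with value - c^2/|x|^2. *)
have [x0|x0] := eqVneq (`|x| ^+ 2) 0.
  by have := var (- c); rewrite x0; nra.
have x2 : 0 < `|x| ^+ 2 by rewrite lt_neqAle eq_sym x0 sqr_ge0.
have := var (- (c / `|x| ^+ 2)).
have -> : (- (c / `|x| ^+ 2)) ^+ 2 * `|x| ^+ 2 + 2 * - (c / `|x| ^+ 2) * c =
  - (c ^+ 2 / `|x| ^+ 2) by field; move: x0; rewrite sqrf_eq0.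
rewrite oppr_ge0 ler_pdivrMr// mul0r => c2.
by apply/eqP; rewrite -sqrf_eq0 eq_le c2 sqr_ge0.
Qed.

(** Since [adjoint] is a choice by [get], existence must be shown. Riesz for u -> <A u, z> gives B
    z; B is linear by [dot_inj] and bounded by Cauchy-Schwarz. *)
Lemma adjointP (A : 'L(H)) x y : dot (A x) y = dot x (adjoint dot A y).
Proof.
have ex z : exists w, forall u, dot (A u) z = dot u w.
  apply: (@riesz _ (opnorm A * `|z|)) => [a u v|u].
    by rewrite (bop_linear A) linearDl /= dotZl.
  apply: le_trans (cauchy_schwarz _ _) _.
  by rewrite mulrAC ler_wpM2r// le_opnorm.
pose B z := projT1 (cid (ex z)).
have BP z u : dot (A u) z = dot u (B z) by rewrite /B; case: cid.
have Blin : bounded_linear B.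
  split.
    move=> a u v; apply: dot_inj => w.
    by rewrite -BP !linearDr !linearZr_LR /= !BP.
  exists (opnorm A) => z.
  have [->|Bz0] := eqVneq (B z) 0; first by rewrite normr0 mulr_ge0 ?opnorm_ge0.
  have Bz : 0 < `|B z| by rewrite normr_gt0.
  rewrite -(ler_pM2l Bz) -expr2 Hdot -BP.
  apply: le_trans (ler_norm _) (le_trans (cauchy_schwarz _ _) _).
  by rewrite mulrA ler_wpM2r// mulrC le_opnorm.
pose S : set 'L(H) := [set C : 'L(H) | forall u v, dot (A u) v = dot u (C v)].
have SB : S (Bop (asboolT Blin)) by move=> u v; exact: BP.
exact: (getI SB).
Qed.

Lemma adjointD (A B : 'L(H)) : adjoint dot (A + B) = adjoint dot A + adjoint dot B.
Proof.
apply: bop_ext => y; apply: dot_inj => x.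
by rewrite -adjointP !bop_addE linearDr linearDl /= !adjointP.
Qed.

(** With w = A* y, |w|^2 = <A w, y> <= |A| |w| when |y| <= 1. *)
Lemma adjoint_norm (A : 'L(H)) : `|adjoint dot A| <= `|A|.
Proof.
rewrite !bop_normE; apply: opnorm_le => y y1.
set w := adjoint dot A y.
have [->|w0] := eqVneq w 0; first by rewrite normr0 opnorm_ge0.
have w1 : 0 < `|w| by rewrite normr_gt0.
rewrite -(ler_pM2l w1) -expr2 Hdot -adjointP.
apply: le_trans (ler_norm _) (le_trans (cauchy_schwarz _ _) _).
apply: le_trans (_ : _ <= `|A w|) _; first by rewrite ler_piMr.
by rewrite mulrC le_opnorm.
Qed.

Definition bcomp_adjoint (A B : 'L(H)) : 'L(H) := bcomp B (adjoint dot A).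

Lemma bcomp_adjoint_contractive : contractive_bilinear bcomp_adjoint.
Proof.
split=> [w v v'|w w' v|w v]; first exact: bcompDl.
- by rewrite /bcomp_adjoint adjointD bcompDr.
- apply: le_trans (bcomp_norm _ _) _.
  by rewrite mulrC ler_wpM2r// adjoint_norm.
Qed.

End Riesz.

(** * Passage between the extended-real seminorms and pointwise bounds *)

Section Seminorms.
Context {R : realType} {H : completeNormedModType R}.
Implicit Types (K Q F : R -> R -> 'L(H)) (T eta alpha zeta B : R).

(** As T > 0, the suprema run over nonempty sets of nonnegative numbers; none takes the value -oo of
    an empty supremum, so each is at most their finite sum. *)
Lemma Knorm_fin T eta K : 0 < T -> Kspace T eta K ->
  exists k, [/\ 0 <= k, Knorm T eta K = k%:E, (Knorm1 T eta K <= k%:E)%E,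
    (Knorm2 T eta K <= k%:E)%E &
    (Knorm3 T eta K <= k%:E)%E /\ (Knorm4 T eta K <= k%:E)%E].
Proof.
move=> T0 Kfin.
have n1 : (0 <= Knorm1 T eta K)%E.
  apply: le_trans (ereal_sup_ubound (_ : [set x | _] _)); last first.
    by exists T, 0; split; [| | |reflexivity].
  by rewrite lee_fin divr_ge0 ?powR_ge0.
have n2 : (0 <= Knorm2 T eta K)%E.
  apply: le_trans (ereal_sup_ubound (_ : [set x | _] _)); last first.
    by exists T, (T / 2), 0, 0; split; [split; lra|reflexivity].
  by rewrite lee_fin divr_ge0 ?mulr_ge0 ?powR_ge0.
have n3 : (0 <= Knorm3 T eta K)%E.
  apply: le_trans (ereal_sup_ubound (_ : [set x | _] _)); last first.
    by exists T, (T / 2), 0, 0; split; [split; lra|reflexivity].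
  by rewrite lee_fin divr_ge0 ?mulr_ge0 ?powR_ge0.
have n4 : (0 <= Knorm4 T eta K)%E.
  apply: le_trans (ereal_sup_ubound (_ : [set x | _] _)); last first.
    exists T, (T / 2), (T / 4), 0, 0, 0.
    by split; [split; lra|split; [lra|lra|reflexivity]].
  by rewrite lee_fin divr_ge0 ?mulr_ge0 ?powR_ge0.
have n0 : (0 <= Knorm T eta K)%E by rewrite !adde_ge0.
have E : Knorm T eta K = (fine (Knorm T eta K))%:E.
  by rewrite fineK// ge0_fin_numE.
exists (fine (Knorm T eta K)); rewrite -!E; split=> //.
- by rewrite fine_ge0.
- by rewrite /Knorm -!addeA leeDl// !adde_ge0.
- by rewrite /Knorm -!addeA addeCA leeDl// !adde_ge0.
- split; last by rewrite /Knorm leeDr// !adde_ge0.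
  by rewrite /Knorm addeAC leeDr// !adde_ge0.
Qed.

(** Takes theta in {0, 1} in [Knorm3] and [Knorm4], theta = zeta in [Knorm2] and nu = zeta in
    [Knorm4]; admissible exponents lie in [0, 1], hence [zeta <= 1]. *)
Lemma Kspace_volterra_kernel T eta zeta K : 0 < T -> 0 <= zeta -> zeta <= 1 ->
  Kspace T eta K -> exists k, [/\ 0 <= k, Knorm T eta K = k%:E &
    volterra_kernel K k eta zeta T].
Proof.
move=> T0 z0 z1 /(Knorm_fin T0)[k [k0 Kk K1 K2 [K3 K4]]].
have ub (S : set (\bar R)) x : (ereal_sup S <= k%:E)%E -> S x%:E -> x <= k.
  by move=> Sk Sx; rewrite -lee_fin; apply: le_trans Sk; exact: ereal_sup_ubound.
exists k; split=> //; split=> [t t0 tT|s t s0 st tT].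
  split=> [r r0 rt|s u s0 su ut].
    have tr0 : 0 < t - r by rewrite subr_gt0.
    have := ub _ (`|K t r| / `|t - r| `^ (- eta)) K1.
    rewrite (gtr0_norm tr0) ler_pdivrMr ?powR_gt0//; apply.
    by exists t, r; split=> //; rewrite gtr0_norm.
  have tu0 : 0 < t - u by rewrite subr_gt0.
  have us0 : 0 < u - s by rewrite subr_gt0.
  have KB theta : 0 <= theta <= 1 -> `|K t u - K t s| <=
      k * ((u - s) `^ theta * (t - u) `^ (- theta - eta)).
    move=> th; rewrite -ler_pdivrMr ?mulr_gt0 ?powR_gt0//.
    apply: ub K3 _; exists t, u, s, theta; split=> //.
    by rewrite !gtr0_norm.
  split; first by have := KB 0; rewrite lexx ler01 powRr0 mul1r oppr0 add0r => /(_ isT).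
  by have := KB 1; rewrite lexx ler01 powRr1 ?(ltW us0)// => /(_ isT).
have ts0 : 0 < t - s by rewrite subr_gt0.
have z01 : 0 <= zeta <= 1 by rewrite z0.
have E : - (eta + zeta) = - zeta - eta by ring.
split=> [r r0 rs|r u r0 ru us].
  have sr0 : 0 < s - r by rewrite subr_gt0.
  rewrite !fctE -mulrA E -ler_pdivrMr ?mulr_gt0 ?powR_gt0//.
  apply: ub K2 _; exists t, s, r, zeta; split=> //.
  by rewrite !gtr0_norm.
have su0 : 0 < s - u by rewrite subr_gt0.
have ur0 : 0 < u - r by rewrite subr_gt0.
have KB theta : 0 <= theta <= 1 -> `|(K t - K s) u - (K t - K s) r| <=
    k * ((s - u) `^ (- zeta - theta - eta) * (t - s) `^ zeta * (u - r) `^ theta).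
  move=> th; rewrite -ler_pdivrMr ?mulr_gt0 ?powR_gt0//.
  apply: ub K4 _; exists t, s, u, r, theta, zeta; split=> //; split=> //.
  rewrite !gtr0_norm//; congr (`| _ | / _)%:E.
  by rewrite !fctE opprB addrA addrAC (addrAC (K t u)).
split.
  have := KB 0; rewrite lexx ler01 powRr0 mulr1 subr0 => /(_ isT).
  by rewrite E -mulrA (mulrC (_ `^ zeta)).
have := KB 1; rewrite lexx ler01 powRr1 ?(ltW ur0)// => /(_ isT) /le_trans; apply.
have -> : -1 - (eta + zeta) = - zeta - 1 - eta by ring.
by rewrite le_eqVlt; apply/orP; left; apply/eqP; ring.
Qed.

Lemma Qspace_regular_covariance T alpha Q : 0 < T -> Qspace T alpha Q ->
  exists q, [/\ 0 <= q, Qnorm T alpha Q = q%:E & regular_covariance Q q alpha T].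
Proof.
move=> T0 Qfin.
have n1 : (0 <= Qnorm10 T alpha Q)%E.
  apply: le_trans (ereal_sup_ubound (_ : [set x | _] _)); last first.
    by exists T, 0, 0; split; [split; lra|reflexivity].
  by rewrite lee_fin divr_ge0 ?powR_ge0.
have n2 : (0 <= Qnorm01 T alpha Q)%E.
  apply: le_trans (ereal_sup_ubound (_ : [set x | _] _)); last first.
    by exists 0, T, 0; split; [split; lra|reflexivity].
  by rewrite lee_fin divr_ge0 ?powR_ge0.
have n3 : (0 <= Qnorm11 T alpha Q)%E.
  apply: le_trans (ereal_sup_ubound (_ : [set x | _] _)); last first.
    by exists T, 0, T, 0; split; [split; lra|split; [lra|lra|lra|reflexivity]].
  by rewrite lee_fin divr_ge0 ?powR_ge0.
have n0 : (0 <= Qnorm T alpha Q)%E by rewrite !adde_ge0.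
have E : Qnorm T alpha Q = (fine (Qnorm T alpha Q))%:E.
  by rewrite fineK// ge0_fin_numE.
set q := fine _ in E.
have Q1 : (Qnorm10 T alpha Q <= q%:E)%E.
  by rewrite -E /Qnorm -addeA leeDl// adde_ge0.
have Q3 : (Qnorm11 T alpha Q <= q%:E)%E by rewrite -E /Qnorm leeDr// adde_ge0.
have ub (S : set (\bar R)) x : (ereal_sup S <= q%:E)%E -> S x%:E -> x <= q.
  by move=> Sq Sx; rewrite -lee_fin; apply: le_trans Sq; exact: ereal_sup_ubound.
exists q; split; [exact: fine_ge0|exact: E|].
split=> [r r0 rT s u s0 su uT|r u r0 ru uT s t s0 st tT].
  have us0 : 0 < u - s by rewrite subr_gt0.
  rewrite -ler_pdivrMr ?powR_gt0//; apply: ub Q1 _; exists u, s, r.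
  by rewrite gtr0_norm//; split=> //; split=> //; rewrite r0.
have ts0 : 0 < t - s by rewrite subr_gt0.
have ur0 : 0 < u - r by rewrite subr_gt0.
rewrite -mulrA -powRM ?(ltW ts0) ?(ltW ur0)// (mulrC (u - r)).
rewrite -ler_pdivrMr ?powR_gt0 ?mulr_gt0//; apply: ub Q3 _; exists t, s, u, r.
split=> //; split=> //; rewrite !gtr0_norm//; congr (`| _ | / _)%:E.
by rewrite /rect_incr /= !fctE opprB addrA addrAC.
Qed.

(* The real-valued counterpart of [Qnorm T zeta F <= 3 * B]. *)
Definition increment_bound F B zeta T :=
  [/\ forall s t t', 0 <= s -> s < t -> t <= T -> 0 <= t' -> t' <= T ->
        `|F t t' - F s t'| <= B * (t - s) `^ zeta,
      forall t s' t', 0 <= t -> t <= T -> 0 <= s' -> s' < t' -> t' <= T ->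
        `|F t t' - F t s'| <= B * (t' - s') `^ zeta &
      forall s t s' t', 0 <= s -> s < t -> t <= T -> 0 <= s' -> s' < t' -> t' <= T ->
        `|F t t' - F t s' - F s t' + F s s'| <= B * ((t - s) * (t' - s')) `^ zeta].

Lemma increment_boundD F F' B B' zeta T : increment_bound F B zeta T ->
  increment_bound F' B' zeta T -> increment_bound (F + F') (B + B') zeta T.
Proof.
move=> [F1 F2 F3] [F'1 F'2 F'3].
split=> [s t t' h1 h2 h3 h4 h5|t s t' h1 h2 h3 h4 h5|s t s' t' h1 h2 h3 h4 h5 h6].
- rewrite mulrDl !fctE opprD addrACA; apply: le_trans (ler_normD _ _) _.
  by apply: lerD; [exact: F1|exact: F'1].
- rewrite mulrDl !fctE opprD addrACA; apply: le_trans (ler_normD _ _) _.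
  by apply: lerD; [exact: F2|exact: F'2].
- rewrite mulrDl !fctE !opprD (addrACA (F t t')) (addrACA (F t t' - F t s')).
  rewrite (addrACA (F t t' - F t s' - F s t')).
  apply: le_trans (ler_normD _ _) _.
  by apply: lerD; [exact: F3|exact: F'3].
Qed.

(** Needed because [volterra_int] is identified with an iterated integral only for times in
    [0, T]. *)
Lemma increment_bound_ext F F' B zeta T :
  (forall t t', 0 <= t -> t <= T -> 0 <= t' -> t' <= T -> F t t' = F' t t') ->
  increment_bound F B zeta T -> increment_bound F' B zeta T.
Proof.
move=> FF' [F1 F2 F3].
split=> [s t t' h1 h2 h3 h4 h5|t s t' h1 h2 h3 h4 h5|s t s' t' h1 h2 h3 h4 h5 h6].
- by rewrite -!FF' ?F1//; lra.
- by rewrite -!FF' ?F2//; lra.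
- by rewrite -!FF' ?F3//; lra.
Qed.

Lemma increment_bound_Qnorm F B zeta T : increment_bound F B zeta T ->
  (Qnorm T zeta F <= (3 * B)%:E)%E.
Proof.
move=> [F1 F2 F3]; rewrite (_ : 3 * B = B + B + B); last by ring.
rewrite !EFinD; apply: leeD; first apply: leeD.
- apply: ub_ereal_sup => _ [t [s [t' [[s0 st tT /andP[t'0 t'T]] ->]]]].
  have ts0 : 0 < t - s by rewrite subr_gt0.
  by rewrite lee_fin gtr0_norm// ler_pdivrMr ?powR_gt0// F1.
- apply: ub_ereal_sup => _ [t [t' [s' [[/andP[t0 tT] s'0 st' t'T] ->]]]].
  have ts0 : 0 < t' - s' by rewrite subr_gt0.
  by rewrite lee_fin gtr0_norm// ler_pdivrMr ?powR_gt0// F2.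
- apply: ub_ereal_sup => _ [t [s [t' [s' [[s0 st tT] [s'0 st' t'T ->]]]]]].
  have ts0 : 0 < t - s by rewrite subr_gt0.
  have ts'0 : 0 < t' - s' by rewrite subr_gt0.
  by rewrite lee_fin !gtr0_norm// ler_pdivrMr ?powR_gt0 ?mulr_gt0// F3.
Qed.

End Seminorms.

(** After exchanging the sums, the composition with the adjoint leaves the inner sum by additivity,
    and the rectangular increment is an increment in r' of increments in r. *)
Lemma riemann_sum2E (R : realType) (H : completeNormedModType R)
    (dot : {dot H for idfun}) (K Q : R -> R -> 'L(H)) (tau tau' : R) :
  riemann_sum2 dot K Q tau tau' =
  double_sum (@bcomp R H) (bcomp_adjoint dot) (K tau) (K tau') Q.
Proof.
apply/funext => PP; rewrite /riemann_sum2 exchange_big; apply: eq_bigr => j _ /=.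
rewrite -(riemann_sumBr (@bcomp_contractive R H)) /bcomp_adjoint.
rewrite (big_morph (fun A => bcomp A _) (fun A B => bcompDl A B _)
  (act0l (@bcomp_contractive R H) _)).
apply: eq_bigr => i _; congr (bcomp (bcomp _ _) _).
by rewrite /rect_incr /= !fctE opprB addrA addrAC.
Qed.

(** * Bounds for the Volterra integral and for differences of two of them *)

Section VolterraDoubleIntegral.
Context {R : realType} {H : completeNormedModType R} (dot : {dot H for idfun}).
Hypothesis Hdot : norm_from_dot dot.
Context {T alpha eta zeta : R}.
Hypotheses (T_gt0 : 0 < T) (eta_ge0 : 0 <= eta) (zeta_ge0 : 0 <= zeta).
Hypothesis zeta_lt : 0 < alpha - (eta + zeta).
Implicit Types K L Q : R -> R -> 'L(H).

Let beta_gt0 : 0 < alpha - eta. Proof. by move: zeta_ge0 zeta_lt; lra. Qed.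

(* Two different kernels: trilinearity reduces continuity to the bound. *)
Definition volterra_int3 K L Q t t' :=
  double_integral (@bcomp R H) (bcomp_adjoint dot) (K t) (L t') Q t t'.

Lemma volterra_sum_cvg K L Q k l q t t' :
  volterra_kernel K k eta zeta T -> volterra_kernel L l eta zeta T ->
  regular_covariance Q q alpha T -> 0 <= k -> 0 <= l -> 0 <= q ->
  0 <= t -> t <= T -> 0 <= t' -> t' <= T ->
  double_sum (@bcomp R H) (bcomp_adjoint dot) (K t) (L t') Q
    @ filter_prod (partitions 0 t) (partitions 0 t') --> volterra_int3 K L Q t t'.
Proof.
move=> [Kk _] [Ll _] Qq k0 l0 q0 t0 tT t'0 t'T.
exact: (double_sum_cvg bcomp_contractive (bcomp_adjoint_contractive Hdot)
  (Kk t t0 tT) (Ll t' t'0 t'T) eta_ge0 k0 l0 q0 beta_gt0 Qq t0 tT t'0 t'T).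
Qed.

Lemma volterra_intE K Q k q t t' :
  volterra_kernel K k eta zeta T -> regular_covariance Q q alpha T ->
  0 <= k -> 0 <= q -> 0 <= t -> t <= T -> 0 <= t' -> t' <= T ->
  volterra_int dot K Q t t' = volterra_int3 K K Q t t'.
Proof.
move=> Kk Qq k0 q0 t0 tT t'0 t'T.
have PF := partitions_proper t0; have PF' := partitions_proper t'0.
(* Since the double sums converge, [lim] is their true limit and not a default value. *)
apply: cvg_lim => //; rewrite riemann_sum2E.
exact: (volterra_sum_cvg Kk Kk Qq).
Qed.

Lemma volterra_int3_bound K L Q k l q :
  volterra_kernel K k eta zeta T -> volterra_kernel L l eta zeta T ->
  regular_covariance Q q alpha T -> 0 <= k -> 0 <= l -> 0 <= q ->
  increment_bound (volterra_int3 K L Q)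
    (volterra_const eta alpha zeta T ^+ 2 * (k * l * q)) zeta T.
Proof.
move=> Kk Ll Qq k0 l0 q0; have c2 := bcomp_adjoint_contractive Hdot.
split=> *.
- exact: (double_integral_incr10 bcomp_contractive c2 Kk Ll Qq).
- exact: (double_integral_incr01 bcomp_contractive c2 Kk Ll Qq).
- exact: (double_integral_incr11 bcomp_contractive c2 Kk Ll Qq).
Qed.

Lemma volterra_int_bound K Q k q :
  volterra_kernel K k eta zeta T -> regular_covariance Q q alpha T ->
  0 <= k -> 0 <= q ->
  increment_bound (volterra_int dot K Q)
    (volterra_const eta alpha zeta T ^+ 2 * (k * k * q)) zeta T.
Proof.
move=> Kk Qq k0 q0.
apply: increment_bound_ext (volterra_int3_bound Kk Kk Qq k0 k0 q0) => t t' *.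
by rewrite (volterra_intE Kk Qq).
Qed.

(** The three summands bound (K' - K, K', Q'), (K, K' - K, Q') and (K, K, Q' - Q), with k + d and q
    + d' as bounds for K' and Q'. *)
Lemma volterra_intB_bound K Q K' Q' k q d d' :
  volterra_kernel K k eta zeta T -> regular_covariance Q q alpha T ->
  volterra_kernel (K' - K) d eta zeta T -> regular_covariance (Q' - Q) d' alpha T ->
  0 <= k -> 0 <= q -> 0 <= d -> 0 <= d' ->
  increment_bound (volterra_int dot K' Q' - volterra_int dot K Q)
    (volterra_const eta alpha zeta T ^+ 2 *
      (d * (k + d) * (q + d') + k * d * (q + d') + k * k * d')) zeta T.
Proof.
move=> Kk Qq Kd Qd k0 q0 d0 d'0.
have kd0 := addr_ge0 k0 d0; have qd0 := addr_ge0 q0 d'0.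
have Kk' : volterra_kernel K' (k + d) eta zeta T.
  by have := volterra_kernelD Kk Kd; rewrite addrC subrK.
have Qq' : regular_covariance Q' (q + d') alpha T.
  by have := regular_covarianceD Qq Qd; rewrite addrC subrK.
rewrite 2!mulrDr.
apply: increment_bound_ext (increment_boundD (increment_boundD
  (volterra_int3_bound Kd Kk' Qq' d0 kd0 qd0) (volterra_int3_bound Kk Kd Qq' k0 d0 qd0))
  (volterra_int3_bound Kk Kk Qd k0 k0 d'0)) => t t' t0 tT t'0 t'T.
have PF := partitions_proper t0; have PF' := partitions_proper t'0.
have -> : (volterra_int dot K' Q' - volterra_int dot K Q) t t' =
    volterra_int3 K' K' Q' t t' - volterra_int3 K K Q t t'.
  by rewrite !fctE (volterra_intE Kk Qq)// (volterra_intE Kk' Qq').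
have -> := double_sum_telescope bcomp_contractive
  (bcomp_adjoint_contractive Hdot)
  (volterra_sum_cvg Kk Kk Qq k0 k0 q0 t0 tT t'0 t'T)
  (volterra_sum_cvg Kk' Kk' Qq' kd0 kd0 qd0 t0 tT t'0 t'T)
  (volterra_sum_cvg Kd Kk' Qq' d0 kd0 qd0 t0 tT t'0 t'T)
  (volterra_sum_cvg Kk Kd Qq' k0 d0 qd0 t0 tT t'0 t'T)
  (volterra_sum_cvg Kk Kk Qd k0 k0 d'0 t0 tT t'0 t'T).
by [].
Qed.

End VolterraDoubleIntegral.

Theorem proposition20 (R : realType) (H : completeNormedModType R)
    (dot : {dot H for idfun}) (Hdot : norm_from_dot dot) (Hsep : separable H)
    (T alpha eta : R) (T_gt0 : 0 < T) (Halpha : 0 < alpha < 1)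
    (Heta : 0 <= eta < 1) (Halphaeta : 0 < alpha - eta) :
  (* the limits defining the integral exist *)
  (forall K Q : R -> R -> 'L(H), Kspace T eta K -> Qspace T alpha Q ->
     forall t t' : R, 0 <= t <= T -> 0 <= t' <= T ->
       cvg (integral2_sums dot K Q t t' t t')) /\
  forall zeta : R, 0 <= zeta < alpha - eta ->
    [/\ (* the map takes its values in Q_zeta *)
        forall K Q : R -> R -> 'L(H), Kspace T eta K -> Qspace T alpha Q ->
          Qspace T zeta (volterra_int dot K Q),
        (* it is continuous for the (semi-)norms *)
        forall K Q : R -> R -> 'L(H), Kspace T eta K -> Qspace T alpha Q ->
        forall e : R, 0 < e -> exists2 d : R, 0 < d &
          forall K' Q' : R -> R -> 'L(H),
            Kspace T eta K' -> Qspace T alpha Q' ->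
            (Knorm T eta (K' - K)%R < d%:E)%E ->
            (Qnorm T alpha (Q' - Q)%R < d%:E)%E ->
            (Qnorm T zeta (volterra_int dot K' Q' - volterra_int dot K Q)%R
               < e%:E)%E
      & (* quantitative bound *)
        exists2 C : R, 0 < C &
          forall K Q : R -> R -> 'L(H), Kspace T eta K -> Qspace T alpha Q ->
            (Qnorm T zeta (volterra_int dot K Q)
               <= C%:E * (Knorm T eta K) ^+ 2 * Qnorm T alpha Q)%E ].
Proof.
have eta0 : 0 <= eta by case/andP: Heta.
have alpha1 : alpha < 1 by case/andP: Halpha.
(* Here [zeta <= 1] follows from alpha < 1 and eta >= 0. *)
have kernel zeta (K : R -> R -> 'L(H)) : 0 <= zeta -> zeta < alpha - eta ->
    Kspace T eta K ->
    exists k, [/\ 0 <= k, Knorm T eta K = k%:E & volterra_kernel K k eta zeta T].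
  by move=> z0 zab; apply: Kspace_volterra_kernel => //; lra.
split=> [K Q KK QQ t t' /andP[t0 tT] /andP[t'0 t'T]|zeta /andP[z0 zab]].
  (* Existence of the limits concerns fixed times, so zeta = 0 suffices. *)
  have [k [k0 _ Kk]] := kernel 0 K (lexx _) Halphaeta KK.
  have [q [q0 _ Qq]] := Qspace_regular_covariance T_gt0 QQ.
  apply/cvg_ex; exists (volterra_int3 dot K K Q t t').
  rewrite /integral2_sums riemann_sum2E.
  by apply: (volterra_sum_cvg Hdot _ _ _ Kk Kk Qq) => //; rewrite addr0.
have zeta_lt : 0 < alpha - (eta + zeta) by lra.
set D := volterra_const eta alpha zeta T.
have D0 : 0 < D by exact: volterra_const_gt0.
(* The 3 counts the seminorms in [Qnorm]; each variable contributes one D. *)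
have D2 : 0 < 3 * D ^+ 2 by rewrite mulr_gt0// exprn_gt0.
split.
- move=> K Q KK QQ; have [k [k0 _ Kk]] := kernel zeta K z0 zab KK.
  have [q [q0 _ Qq]] := Qspace_regular_covariance T_gt0 QQ.
  apply: le_lt_trans (ltry _); apply: increment_bound_Qnorm.
  exact: (volterra_int_bound Hdot T_gt0 eta0 z0 zeta_lt Kk Qq k0 q0).
- move=> K Q KK QQ e e0; have [k [k0 _ Kk]] := kernel zeta K z0 zab KK.
  have [q [q0 _ Qq]] := Qspace_regular_covariance T_gt0 QQ.
  (* For d, d' <= 1 the polynomial of [volterra_intB_bound] is at most max(d, d') M, which dictates
     the radius chosen below. *)
  pose M := (k + 1) * (q + 1) + k * (q + 1) + k * k.
  have M0 : 0 < M.
    by rewrite /M !ltr_wpDr ?mulr_gt0 ?mulr_ge0 ?addr_ge0 ?ltr_wpDl.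
  exists (Num.min 1 (e / (3 * D ^+ 2 * M))).
    by rewrite lt_min ltr01 divr_gt0// mulr_gt0.
  move=> K' Q' _ _ Kd Qd.
  have [d [d0 Kd' Kd'']] := kernel zeta (K' - K) z0 zab (lt_trans Kd (ltry _)).
  have [d' [d'0 Qd' Qd'']] :=
    Qspace_regular_covariance T_gt0 (lt_trans Qd (ltry _) : Qspace T alpha (Q' - Q)).
  rewrite Kd' lte_fin lt_min in Kd; rewrite Qd' lte_fin lt_min in Qd.
  have [/ltW d1 de] := andP Kd; have [/ltW d'1 d'e] := andP Qd.
  apply: le_lt_trans (increment_bound_Qnorm
    (volterra_intB_bound Hdot T_gt0 eta0 z0 zeta_lt Kk Qq Kd'' Qd'' k0 q0 d0 d'0)) _.
  rewrite lte_fin -/D mulrA; set m := Num.max d d'.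
  have me : m < e / (3 * D ^+ 2 * M) by rewrite gt_max de.
  rewrite ltr_pdivlMr ?mulr_gt0// in me; apply: le_lt_trans me.
  rewrite [leRHS]mulrCA ler_pM2l//.
  have dm : d <= m by rewrite le_max lexx.
  have d'm : d' <= m by rewrite le_max lexx orbT.
  have q1 : q + d' <= q + 1 by rewrite lerD2l.
  have k1 : k + d <= k + 1 by rewrite lerD2l.
  have m0 := le_trans d0 dm.
  rewrite /M 2!(mulrDr m); apply: lerD; first apply: lerD.
  + rewrite [leRHS]mulrA; apply: ler_pM; rewrite ?mulr_ge0 ?addr_ge0//.
    by apply: ler_pM; rewrite ?addr_ge0.
  + rewrite [leRHS]mulrCA [leRHS]mulrA; apply: ler_pM; rewrite ?mulr_ge0 ?addr_ge0//.
    by rewrite ler_wpM2l.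
  + by rewrite [leRHS]mulrC ler_wpM2l// mulr_ge0.
- exists (3 * D ^+ 2) => // K Q KK QQ.
  have [k [k0 -> Kk]] := kernel zeta K z0 zab KK.
  have [q [q0 -> Qq]] := Qspace_regular_covariance T_gt0 QQ.
  apply: le_trans (increment_bound_Qnorm
    (volterra_int_bound Hdot T_gt0 eta0 z0 zeta_lt Kk Qq k0 q0)) _.
  by rewrite expe2 -!EFinM lee_fin -/D expr2 !mulrA.
Qed.
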